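(* Let $m,n$ be positive integers, $d=m+n$. Assume $c>0$, $\delta<1$, $\ell\in\mathbb{N}$, and for every $1\le i\le \ell$ let $\mathbf{N}_i=(N_{i,1},\dots,N_{i,d})\in\mathbb{N}^d$ and $\mathbf{v}_i=(v_{i,1},\dots,v_{i,d})\in\mathbb{Z}^d$. Then for Lebesgue-almost every $\theta\in\mathrm{M}_{m,n}(\mathbb{R})$ there exist infinitely many $Q\in\mathbb{N}$ for which there is a collection $\{(\mathbf{p}_i,\mathbf{q}_i)\}_{1\le i\le \ell}\subseteq \mathbb{Z}^m\times\mathbb{Z}^n$ satisfying: (1) $\|\mathbf{q}_i\|\le Q$ for every $1\le i\le\ell$; (2) $\|\theta\mathbf{q}_1+\mathbf{p}_1\|^m\le cQ^{-n}$; (3) $\|\theta\mathbf{q}_i+\mathbf{p}_i\|^m\le cQ^{-\delta n}$ for every $2\le i\le \ell$; (4) $p_{i,j}\equiv v_{i,j}\pmod{N_{i,j}}$ and $q_{i,r}\equiv v_{i,m+r}\pmod{N_{i,m+r}}$ for all $1\le i\le \ell$, $1\le j\le m$, $1\le r\le n$.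
   Context: $\mathrm{M}_{m,n}(\mathbb{R})$ denotes the space of real $m\times n$ matrices. $\|\cdot\|$ denotes the maximum norm on $\mathbb{R}^k$. The coordinates of $\mathbf{p}_i\in\mathbb{Z}^m$ are $p_{i,1},\dots,p_{i,m}$ and those of $\mathbf{q}_i\in\mathbb{Z}^n$ are $q_{i,1},\dots,q_{i,n}$. *)

(* Defs.v *)
From Stdlib Require Import Reals ZArith List Lra.
Import ListNotations.
Open Scope R_scope.

(* A real m x n matrix is represented by its entries theta j r, j < m, r < n;
   entries outside this range are irrelevant. *)
Definition mat := nat -> nat -> R.

Definition supnorm (k : nat) (x : nat -> R) : R :=
  fold_right Rmax 0 (map (fun j => Rabs (x j)) (seq 0 k)).

Fixpoint prodR (K : nat) (f : nat -> R) : R :=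
  match K with O => 1 | S K' => prodR K' f * f K' end.

Fixpoint sumR (K : nat) (f : nat -> R) : R :=
  match K with O => 0 | S K' => sumR K' f + f K' end.

Definition lin_form (m n : nat) (theta : mat) (q p : nat -> Z) : nat -> R :=
  fun j => sumR n (fun r => theta j r * IZR (q r)) + IZR (p j).

Definition box_vol (m n : nat) (a b : mat) : R :=
  prodR m (fun j => prodR n (fun r => b j r - a j r)).

Definition in_box (m n : nat) (a b : mat) (theta : mat) : Prop :=
  forall j r, (j < m)%nat -> (r < n)%nat -> a j r <= theta j r <= b j r.

Definition lebesgue_null (m n : nat) (S : mat -> Prop) : Prop :=
  forall eps, 0 < eps ->
    exists (a b : nat -> mat),
      (forall k j r, (j < m)%nat -> (r < n)%nat -> a k j r <= b k j r) /\
      (forall K, sumR K (fun k => box_vol m n (a k) (b k)) <= eps) /\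
      (forall theta, S theta -> exists k, in_box m n (a k) (b k) theta).

Definition ae_mat (m n : nat) (P : mat -> Prop) : Prop :=
  lebesgue_null m n (fun theta => ~ P theta).

Definition zcong (x v : Z) (N : nat) : Prop :=
  exists k : Z, (x - v)%Z = (k * Z.of_nat N)%Z.

(* Main.v *)
Require Import Defs.
From Stdlib Require Import Reals ZArith List.
From Stdlib Require Import Lra Lia FinFun Classical ClassicalEpsilon.
Import ListNotations.
Open Scope R_scope.

(** Put [X = T^m] and [Y = T^-n]. Call [theta] bad at scale [T] if some integral
    [q <> 0] with [|q| <= X / 24] has [theta q] within [Y / 24] of an integer
    point. If [theta] is not bad, a pigeonhole argument bounds the inhomogeneous
    minima: up to constants, every target is reached within [Y] by [theta q + p]
    with [|q| <= X], even under congruence conditions. As [delta < 1], this is more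
    than (3) asks for. It also gives a first pair with [|q_1|] of order [X] for
    which a perturbation of [theta] of size [O(Y / X)] annihilates
    [theta q_1 + p_1]; so near [theta] there is a cube of side comparable to
    [Y / X] on which (1)-(4) hold.

    Cut an arbitrary cube into cells of side about [Y / X]. A union bound over [q]
    shows that at most half of the cells have a bad corner once [T] is large.
    Hence a fixed proportion [kappa] of every cube satisfies (1)-(4), and the rest
    is a finite union of cubes; iterating, the exceptional set is covered by cubes
    of total volume [(1 - kappa)^i] times the initial one. This replaces the
    Lebesgue density theorem. *)

(** * Counting *)

Lemma choice {A B : Type} (P : A -> B -> Prop) :
  (forall x, exists y, P x y) -> exists f, forall x, P x (f x).
Proof.
  intros H. exists (fun x => proj1_sig (constructive_indefinite_description _ (H x))).
  intros x. apply proj2_sig.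
Qed.

Lemma sumR_ext (K : nat) (f g : nat -> R) :
  (forall r, (r < K)%nat -> f r = g r) -> sumR K f = sumR K g.
Proof.
  induction K as [|K IH]; intros H; simpl; [reflexivity|].
  rewrite IH by (intros; apply H; lia). now rewrite H by lia.
Qed.

Lemma sumR_plus (K : nat) (f g : nat -> R) :
  sumR K (fun r => f r + g r) = sumR K f + sumR K g.
Proof. induction K as [|K IH]; simpl; [lra|rewrite IH; lra]. Qed.

Lemma sumR_scal (K : nat) (x : R) (f : nat -> R) :
  sumR K (fun r => x * f r) = x * sumR K f.
Proof. induction K as [|K IH]; simpl; [lra|rewrite IH; lra]. Qed.

Lemma sumR_abs_le (K : nat) (f : nat -> R) (b : R) :
  (forall r, (r < K)%nat -> Rabs (f r) <= b) -> Rabs (sumR K f) <= INR K * b.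
Proof.
  induction K as [|K IH]; intros H.
  - simpl. rewrite Rabs_R0. lra.
  - rewrite S_INR. simpl. eapply Rle_trans; [apply Rabs_triang|].
    assert (H1 := H K ltac:(lia)).
    assert (H2 := IH ltac:(intros; apply H; lia)). lra.
Qed.

Lemma sumR_update (K r0 : nat) (f g : nat -> R) :
  (r0 < K)%nat -> (forall r, r <> r0 -> f r = g r) ->
  sumR K f = sumR K g + (f r0 - g r0).
Proof.
  intros Hr H. induction K as [|K IH]; [lia|]. simpl.
  destruct (Nat.eq_dec r0 K) as [->|Hne].
  - rewrite (sumR_ext K f g) by (intros; apply H; lia). lra.
  - rewrite IH by lia. rewrite (H K) by lia. lra.
Qed.

Lemma supnorm_le (k : nat) (x : nat -> R) (b : R) :
  0 <= b -> (forall j, (j < k)%nat -> Rabs (x j) <= b) -> supnorm k x <= b.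
Proof.
  intros Hb H. unfold supnorm.
  assert (G : forall l, (forall j, In j l -> (j < k)%nat) ->
    fold_right Rmax 0 (map (fun j => Rabs (x j)) l) <= b).
  { induction l as [|j l IH]; intros Hl; simpl; [exact Hb|].
    apply Rmax_lub; [apply H, Hl; now left|].
    apply IH; intros; apply Hl; now right. }
  apply G. intros j Hj. apply in_seq in Hj. lia.
Qed.

Lemma supnorm_ge0 (k : nat) (x : nat -> R) : 0 <= supnorm k x.
Proof.
  unfold supnorm. induction (seq 0 k) as [|j l IH]; simpl; [lra|].
  eapply Rle_trans; [apply IH|apply Rmax_r].
Qed.

Lemma prodR_const (K : nat) (f : nat -> R) (x : R) :
  (forall r, (r < K)%nat -> f r = x) -> prodR K f = x ^ K.
Proof.
  induction K as [|K IH]; intros H; simpl; [reflexivity|].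
  rewrite IH by (intros; apply H; lia). rewrite H by lia. ring.
Qed.

Lemma pow_le_1_self (x : R) (k : nat) : 0 <= x <= 1 -> (0 < k)%nat -> x ^ k <= x.
Proof.
  intros Hx Hk. destruct k as [|k]; [lia|]. simpl.
  assert (x ^ k <= 1) by (rewrite <- (pow1 k); apply pow_incr; lra).
  assert (0 <= x ^ k) by (apply pow_le; lra). nra.
Qed.

Lemma archimed_nat (x : R) : exists k : nat, forall k', (k <= k')%nat -> x <= INR k'.
Proof.
  exists (Z.to_nat (up x)). intros k' Hk'.
  destruct (archimed x) as [H _].
  destruct (Z_le_gt_dec 0 (up x)) as [H0|H0].
  - apply le_INR in Hk'. rewrite INR_IZR_INZ, Z2Nat.id in Hk' by lia. lra.
  - assert (IZR (up x) < 0) by (apply IZR_lt; lia).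
    assert (0 <= INR k') by apply pos_INR. lra.
Qed.

Lemma Rabs_le_inv (x y : R) : Rabs x <= y -> - y <= x <= y.
Proof. unfold Rabs. destruct Rcase_abs; lra. Qed.

(** Real-valued and decided by excluded middle, so that arbitrary predicates can be counted and the
    counts compared by linear arithmetic. *)
Definition indicator (P : Prop) : R := if excluded_middle_informative P then 1 else 0.

Fixpoint count {A : Type} (P : A -> Prop) (l : list A) : R :=
  match l with [] => 0 | x :: l' => indicator (P x) + count P l' end.

Lemma indicator_true (P : Prop) : P -> indicator P = 1.
Proof. unfold indicator. destruct excluded_middle_informative; tauto. Qed.

Lemma indicator_false (P : Prop) : ~ P -> indicator P = 0.
Proof. unfold indicator. destruct excluded_middle_informative; tauto. Qed.

Lemma indicator_bounds (P : Prop) : 0 <= indicator P <= 1.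
Proof. unfold indicator. destruct excluded_middle_informative; lra. Qed.

Lemma count_ge0 {A} (P : A -> Prop) l : 0 <= count P l.
Proof. induction l; simpl; [lra|]. pose proof (indicator_bounds (P a)). lra. Qed.

Lemma count_le {A} (P Q : A -> Prop) l :
  (forall x, In x l -> P x -> Q x) -> count P l <= count Q l.
Proof.
  induction l as [|x l IH]; intros H; simpl; [lra|].
  assert (H1 : count P l <= count Q l) by (apply IH; intros; apply H; simpl; auto).
  assert (indicator (P x) <= indicator (Q x)).
  { unfold indicator at 1. destruct excluded_middle_informative as [p|p].
    - rewrite indicator_true; [lra|]. apply H; simpl; auto.
    - apply indicator_bounds. }
  lra.
Qed.

Lemma count_app {A} (P : A -> Prop) l l' : count P (l ++ l') = count P l + count P l'.
Proof. induction l as [|x l IH]; simpl; [lra|rewrite IH; lra]. Qed.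

Lemma count_map {A B} (f : A -> B) (P : B -> Prop) l :
  count P (map f l) = count (fun x => P (f x)) l.
Proof. induction l as [|x l IH]; simpl; [lra|rewrite IH; lra]. Qed.

Lemma count_or {A} (P Q : A -> Prop) l :
  count (fun x => P x \/ Q x) l <= count P l + count Q l.
Proof.
  induction l as [|x l IH]; simpl; [lra|].
  assert (indicator (P x \/ Q x) <= indicator (P x) + indicator (Q x)).
  { pose proof (indicator_bounds (P x)). pose proof (indicator_bounds (Q x)).
    destruct (classic (P x)) as [p|p].
    - pose proof (indicator_bounds (P x \/ Q x)). rewrite (indicator_true (P x)) by auto. lra.
    - destruct (classic (Q x)) as [q|q].
      + pose proof (indicator_bounds (P x \/ Q x)). rewrite (indicator_true (Q x)) by auto. lra.
      + rewrite indicator_false by tauto. lra. }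
  lra.
Qed.

Lemma count_none {A} (P : A -> Prop) l : (forall x, In x l -> ~ P x) -> count P l = 0.
Proof.
  induction l as [|x l IH]; intros H; simpl; [lra|].
  rewrite IH by (intros; apply H; simpl; auto).
  rewrite indicator_false by (apply H; simpl; auto). lra.
Qed.

(** Union bound. [P] is generalised in the induction because at each stage it is replaced by the
    union of the remaining [S i]. *)
Lemma count_union {A I} (P : A -> Prop) (S : I -> A -> Prop) (is : list I) l (b : R) :
  (forall x, In x l -> P x -> exists i, In i is /\ S i x) ->
  (forall i, In i is -> count (S i) l <= b) ->
  count P l <= INR (length is) * b.
Proof.
  revert P. induction is as [|i is IH]; intros P H Hb.
  - simpl. rewrite count_none; [lra|].
    intros x Hx HP. destruct (H x Hx HP) as (i & [] & _).
  - cbn [length]. rewrite S_INR.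
    apply Rle_trans with (count (fun x => S i x \/ exists i', In i' is /\ S i' x) l).
    + apply count_le. intros x Hx HP. destruct (H x Hx HP) as (i' & [->|Hi] & HS); eauto.
    + eapply Rle_trans; [apply count_or|].
      assert (H1 : count (fun x => exists i', In i' is /\ S i' x) l <= INR (length is) * b).
      { apply IH; [auto|]. intros; apply Hb; simpl; auto. }
      assert (H2 := Hb i ltac:(simpl; auto)). lra.
Qed.

Lemma count_flat_map {A B} (f : A -> list B) (P : B -> Prop) (Q : A -> Prop) l (b : R) :
  (forall x, In x l -> ~ Q x -> forall y, In y (f x) -> ~ P y) ->
  (forall x, In x l -> count P (f x) <= b) ->
  count P (flat_map f l) <= count Q l * b.
Proof.
  induction l as [|x l IH]; intros H1 H2; simpl; [lra|].
  rewrite count_app.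
  assert (H3 : count P (flat_map f l) <= count Q l * b).
  { apply IH; intros; [apply (H1 x0)|apply H2]; simpl; auto. }
  destruct (classic (Q x)) as [q|q].
  - rewrite indicator_true by auto. assert (H4 := H2 x ltac:(simpl; auto)). lra.
  - rewrite indicator_false by auto. rewrite (count_none P (f x)) by (apply H1; simpl; auto). lra.
Qed.

(** * Words over a finite alphabet and counting in products *)

Fixpoint words {A : Type} (l : list A) (n : nat) : list (list A) :=
  match n with
  | O => [[]]
  | S n' => flat_map (fun x => map (cons x) (words l n')) l
  end.

Lemma count_total {A} (l : list A) : count (fun _ => True) l = INR (length l).
Proof.
  induction l as [|x l IH]; [reflexivity|].
  cbn [length]. rewrite S_INR. simpl. rewrite IH, indicator_true by auto. lra.
Qed.

Lemma count_le_length {A} (P : A -> Prop) (l : list A) : count P l <= INR (length l).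
Proof. rewrite <- count_total. now apply count_le. Qed.

Lemma words_length {A} (l : list A) n : length (words l n) = (length l ^ n)%nat.
Proof.
  induction n as [|n IH]; [reflexivity|]. simpl. rewrite <- IH.
  clear IH. generalize (words l n) as W. intros W.
  induction l as [|x l IHl]; simpl; [reflexivity|].
  now rewrite length_app, length_map, IHl.
Qed.

Lemma in_words {A} (l : list A) n w :
  In w (words l n) <-> length w = n /\ (forall x, In x w -> In x l).
Proof.
  revert w. induction n as [|n IH]; intros w; simpl.
  - split.
    + intros [<-|[]]. simpl. tauto.
    + intros [H _]. left. destruct w; [reflexivity|discriminate].
  - rewrite in_flat_map. split.
    + intros (x & Hx & Hw). apply in_map_iff in Hw as (w' & <- & Hw').
      apply IH in Hw' as [Hl Hw']. simpl. split; [lia|].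
      intros y [<-|Hy]; auto.
    + intros [Hl Hw]. destruct w as [|x w]; [discriminate|].
      exists x. split; [apply Hw; simpl; auto|].
      apply in_map. apply IH. split; [simpl in Hl; lia|].
      intros; apply Hw; simpl; auto.
Qed.

Lemma words_NoDup {A} (l : list A) n : NoDup l -> NoDup (words l n).
Proof.
  intros Hl. induction n as [|n IH]; simpl.
  - repeat constructor. simpl. tauto.
  - revert IH. generalize (words l n) as W. intros W HW.
    induction Hl as [|x l Hx Hl IHl]; simpl; [constructor|].
    apply NoDup_app; [|apply IHl|].
    + apply Injective_map_NoDup; [|exact HW]. intros u v H. now injection H.
    + intros w Hw Hw'. apply in_map_iff in Hw as (u & <- & _).
      apply in_flat_map in Hw' as (y & Hy & Hw'). apply in_map_iff in Hw' as (u' & E & _).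
      injection E. intros. subst. contradiction.
Qed.

(** Constraints on distinct letters are independent, so the bounds multiply: the first letter has at
    most [b] admissible values, and the fibre over each is bounded by induction. *)
Lemma count_words_all {A} (l : list A) (d : A) (n : nat) (P : nat -> A -> Prop) (b : R) :
  (forall j, (j < n)%nat -> count (P j) l <= b) ->
  count (fun w => forall j, (j < n)%nat -> P j (nth j w d)) (words l n) <= b ^ n.
Proof.
  revert P. induction n as [|n IH]; intros P H.
  - eapply Rle_trans; [apply count_le_length|]. simpl. lra.
  - cbn [words pow].
    assert (Hb : 0 <= b) by (eapply Rle_trans; [apply (count_ge0 (P 0%nat) l)|apply (H 0%nat); lia]).
    eapply Rle_trans; [apply (count_flat_map _ _ (P 0%nat) l (b ^ n))|].
    + intros x _ Hx y Hy Hall. apply in_map_iff in Hy as (w & <- & _).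
      apply Hx, (Hall 0%nat). lia.
    + intros x _. rewrite count_map.
      eapply Rle_trans; [|apply (IH (fun j => P (S j)))].
      * apply count_le. intros w _ Hall j Hj. apply (Hall (S j)). lia.
      * intros j Hj. apply H. lia.
    + apply Rmult_le_compat_r; [now apply pow_le|]. apply H. lia.
Qed.

(** Exchanges the two loops of [words]: the list is sliced by the tail [w] rather than by the first
    letter. *)
Lemma count_words_cons {A} (l : list A) (W : list (list A)) (P : list A -> Prop) (b : R) :
  (forall w, In w W -> count (fun x => P (x :: w)) l <= b) ->
  count P (flat_map (fun x => map (cons x) W) l) <= INR (length W) * b.
Proof.
  induction W as [|w W IH]; intros H.
  - simpl. rewrite count_none; [lra|]. intros y Hy. apply in_flat_map in Hy.
    destruct Hy as (x & _ & []).
  - cbn [length]. rewrite S_INR.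
    assert (E : forall l', count P (flat_map (fun x => map (cons x) (w :: W)) l')
              = count (fun x => P (x :: w)) l' + count P (flat_map (fun x => map (cons x) W) l')).
    { induction l' as [|x l' IHl']; [simpl; lra|]. cbn [flat_map map count].
      rewrite !count_app. cbn [count map] in *. rewrite IHl'. lra. }
    rewrite E.
    assert (H1 := H w ltac:(simpl; auto)).
    assert (H2 := IH ltac:(intros; apply H; simpl; auto)). lra.
Qed.

(** Fubini along coordinate [r]: the words split into [length l ^ (n - 1)] lines in that direction,
    each contributing at most [b]. Earlier letters are stripped by induction until the coordinate
    comes first. *)
Lemma count_words_coord {A} (l : list A) (n r : nat) (P : list A -> Prop) (b : R) :
  (r < n)%nat ->
  (forall u v, length u = r -> count (fun x => P (u ++ x :: v)) l <= b) ->
  count P (words l n) <= b * INR (length l) ^ (n - 1).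
Proof.
  revert n P. induction r as [|r IH]; intros n P Hr H; (destruct n as [|n]; [lia|]);
    cbn [words]; replace (S n - 1)%nat with n by lia.
  - eapply Rle_trans; [apply (count_words_cons l (words l n) P b)|].
    + intros w _. apply (H []); reflexivity.
    + rewrite words_length, pow_INR. lra.
  - eapply Rle_trans; [apply (count_flat_map _ P (fun _ => True) l (b * INR (length l) ^ (n - 1)))|].
    + tauto.
    + intros x _. rewrite count_map. apply IH; [lia|].
      intros u v Hu. apply (H (x :: u) v). simpl; lia.
    + rewrite count_total. destruct n as [|n]; [lia|].
      replace (S n - 1)%nat with n by lia. simpl. lra.
Qed.

Lemma count_seq_diameter (P : nat -> Prop) (M : nat) (D : R) :
  0 <= D ->
  (forall k k', P k -> P k' -> INR k - INR k' <= D) ->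
  count P (seq 0 M) <= D + 1.
Proof.
  intros HD H.
  (* [k0] is the least element of [P]. Below [M] there are at most [M - k0] elements, [Rmax]
     covering the case of [M] below [k0]; when [M] itself is in [P], that number is bounded by the
     diameter. *)
  assert (G : forall M k0, (forall k, (k < k0)%nat -> ~ P k) -> P k0 ->
            count P (seq 0 M) <= Rmax 0 (INR M - INR k0) /\ count P (seq 0 M) <= D + 1).
  { clear M. intros M k0 Hk0 P0. induction M as [|M IH].
    - simpl. split; [apply Rmax_l|lra].
    - rewrite seq_S, count_app. cbn [count Nat.add].
      destruct IH as [IH1 IH2]. rewrite S_INR.
      destruct (classic (P M)) as [p|p].
      + rewrite indicator_true by auto.
        assert (k0 <= M)%nat by (destruct (Nat.le_gt_cases k0 M); auto; exfalso; eapply Hk0; eauto).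
        assert (HM : INR k0 <= INR M) by now apply le_INR.
        rewrite Rmax_right in IH1 by lra.
        rewrite Rmax_right by lra. assert (H1 := H M k0 p P0). lra.
      + rewrite indicator_false by auto. split; [|lra].
        eapply Rle_trans with (Rmax 0 (INR M - INR k0)); [lra|].
        apply Rle_max_compat_l. lra. }
  destruct (classic (exists k, P k)) as [[k Hk]|Hno].
  - destruct (dec_inh_nat_subset_has_unique_least_element P) as (k0 & (P0 & Hmin) & _).
    + intros; apply classic.
    + eauto.
    + apply (G M k0); auto. intros k' Hk' Pk'. apply Hmin in Pk'. lia.
  - rewrite count_none; [lra|]. intros x _ Hx. eauto.
Qed.

(** * Arithmetic progressions near the integers *)

Definition near_int (eta y : R) : Prop := exists z : Z, Rabs (y + IZR z) <= eta.

Lemma near_int_opp (eta y : R) : near_int eta y -> near_int eta (- y).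
Proof.
  intros (z & Hz). exists (- z)%Z. rewrite opp_IZR.
  replace (- y + - IZR z) with (- (y + IZR z)) by ring. now rewrite Rabs_Ropp.
Qed.

(** The progression spans a length of at most [M * beta], so at most [M * beta + 3] integers come
    into play; each is within [eta] of at most [2 * (eta / beta) + 1] terms, and this is at most
    [3 * (eta / beta)] because [beta <= eta]. *)
Lemma count_near_int_pos (x beta eta : R) (M : nat) :
  0 < beta <= eta -> eta <= / 2 ->
  count (fun k => near_int eta (x + beta * INR k)) (seq 0 M)
    <= (INR M * beta + 3) * (3 * (eta / beta)).
Proof.
  intros Hbeta Heta.
  set (z0 := Int_part (x - / 2)).
  destruct (base_Int_part (x - / 2)) as [Hz1 Hz2]. fold z0 in Hz1, Hz2.
  pose proof (pos_INR M) as HM.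
  (* As [eta <= / 2], every integer close to a term is one of [z0], ..., [z0 + I - 1]; the integer
     [- z] gets the index [- z - z0]. *)
  set (I := S (Z.to_nat (Int_part (INR M * beta + 2)))).
  assert (HI0 : (0 <= Int_part (INR M * beta + 2))%Z).
  { destruct (base_Int_part (INR M * beta + 2)) as [_ G].
    apply Z.lt_succ_r, lt_IZR. rewrite succ_IZR. nra. }
  assert (HI : INR I <= INR M * beta + 3).
  { unfold I. rewrite S_INR, INR_IZR_INZ, Z2Nat.id by exact HI0.
    destruct (base_Int_part (INR M * beta + 2)) as [G _]. lra. }
  assert (Hq : 1 <= eta / beta).
  { apply Rmult_le_reg_r with beta; [lra|]. unfold Rdiv. rewrite Rmult_assoc, Rinv_l; lra. }
  apply Rle_trans with (INR I * (3 * (eta / beta))); [|apply Rmult_le_compat_r; lra].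
  replace I with (length (seq 0 I)) at 1 by apply length_seq.
  apply count_union with
    (S := fun i k => Rabs (x + beta * INR k - IZR z0 - INR i) <= eta).
  - intros k Hk (z & Hz). apply in_seq in Hk.
    assert (Hk' : INR k <= INR M) by (apply le_INR; lia).
    pose proof (pos_INR k) as Hk0.
    assert (beta * INR k <= INR M * beta) by nra.
    assert (0 <= beta * INR k) by nra.
    apply Rabs_le_inv in Hz.
    assert (Hi0 : (0 <= - z - z0)%Z).
    { apply Z.lt_succ_r, lt_IZR. rewrite succ_IZR, minus_IZR, opp_IZR. lra. }
    exists (Z.to_nat (- z - z0)). split.
    + apply in_seq. unfold I.
      assert (- z - z0 <= Int_part (INR M * beta + 2))%Z; [|lia].
      destruct (base_Int_part (INR M * beta + 2)) as [_ G].
      apply Z.lt_succ_r, lt_IZR. rewrite succ_IZR, minus_IZR, opp_IZR. lra.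
    + rewrite (INR_IZR_INZ (Z.to_nat _)), Z2Nat.id by exact Hi0. rewrite minus_IZR, opp_IZR.
      apply Rabs_le. lra.
  - intros i _.
    apply Rle_trans with (2 * (eta / beta) + 1); [|lra].
    apply count_seq_diameter; [lra|].
    intros k k' Hk Hk'. apply Rabs_le_inv in Hk, Hk'.
    apply Rmult_le_reg_r with beta; [lra|].
    replace (2 * (eta / beta) * beta) with (2 * eta) by (field; lra). nra.
Qed.

Lemma count_near_int (x beta eta : R) (M : nat) :
  0 < Rabs beta <= eta -> eta <= / 2 ->
  count (fun k => near_int eta (x + beta * INR k)) (seq 0 M)
    <= (INR M * Rabs beta + 3) * (3 * (eta / Rabs beta)).
Proof.
  intros Hbeta Heta. destruct (Rle_or_lt 0 beta) as [Hs|Hs].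
  - rewrite (Rabs_right beta) in * by lra. now apply count_near_int_pos.
  - rewrite (Rabs_left beta) in * by lra.
    eapply Rle_trans; [|apply (count_near_int_pos (- x) (- beta) eta M); auto].
    apply count_le. intros k _ Hk.
    replace (- x + - beta * INR k) with (- (x + beta * INR k)) by ring.
    now apply near_int_opp.
Qed.

(** * Bad corners are rare *)

Definition grid (m n M : nat) : list (list (list nat)) := words (words (seq 0 M) n) m.

Definition entry (w : list (list nat)) (j r : nat) : nat := nth r (nth j w []) 0%nat.

Definition bad (m n H : nat) (eta : R) (theta : mat) : Prop :=
  exists q p : nat -> Z,
    (exists r, (r < n)%nat /\ q r <> 0%Z) /\
    (forall r, (r < n)%nat -> (Z.abs (q r) <= Z.of_nat H)%Z) /\
    (forall j, (j < m)%nat -> Rabs (lin_form m n theta q p j) <= eta).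

(** Along coordinate [r0] the form runs through an arithmetic progression of step
    [s / INR M * q r0], so the one-dimensional count applies on every line. *)
Lemma count_row (n r0 M : nat) (a : nat -> R) (q : nat -> Z) (s eta h : R) :
  (r0 < n)%nat -> (0 < M)%nat -> 0 < s -> 0 < h <= Rabs (IZR (q r0)) ->
  s / INR M * Rabs (IZR (q r0)) <= eta -> eta <= / 2 ->
  count (fun w => near_int eta
           (sumR n (fun r => (a r + s / INR M * INR (nth r w 0%nat)) * IZR (q r))))
    (words (seq 0 M) n) <= 3 * eta * (1 + 3 / (s * h)) * INR M ^ n.
Proof.
  intros Hr HM Hs Hh Heta Heta2.
  assert (HM' : 0 < INR M) by now apply lt_0_INR.
  set (sg := s / INR M) in *.
  assert (Hsg : 0 < sg) by (unfold sg; apply Rdiv_lt_0_compat; lra).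
  set (x := Rabs (IZR (q r0))) in *.
  assert (Hbeta : 0 < Rabs (sg * IZR (q r0)) <= eta).
  { rewrite Rabs_mult, (Rabs_right sg) by lra. fold x. split; [nra|exact Heta]. }
  eapply Rle_trans;
    [apply (count_words_coord _ n r0 _
       ((INR M * Rabs (sg * IZR (q r0)) + 3) * (3 * (eta / Rabs (sg * IZR (q r0)))))); [exact Hr|]|].
  - intros u v Hu.
    (* The base point of the progression is the row with 0 in place [r0]. *)
    eapply Rle_trans; [|apply (count_near_int
       (sumR n (fun r => (a r + sg * INR (nth r (u ++ 0%nat :: v) 0%nat)) * IZR (q r)))
       (sg * IZR (q r0)) eta M Hbeta Heta2)].
    apply count_le. intros t _ Ht.
    rewrite (sumR_update n r0 _
       (fun r => (a r + sg * INR (nth r (u ++ 0%nat :: v) 0%nat)) * IZR (q r)) Hr) in Ht.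
    + assert (En : forall t', nth r0 (u ++ t' :: v) 0%nat = t').
      { intros t'. rewrite app_nth2, Hu, Nat.sub_diag by lia. reflexivity. }
      rewrite !En in Ht.
      match goal with |- near_int _ ?y => match type of Ht with near_int _ ?y' =>
        replace y with y'; [exact Ht|] end end.
      simpl (INR 0). ring.
    + intros r Hne. f_equal. f_equal. f_equal. f_equal.
      destruct (Nat.lt_ge_cases r r0) as [Hlt|Hge].
      * rewrite !app_nth1 by lia. reflexivity.
      * rewrite !app_nth2 by lia. destruct (r - length u)%nat eqn:E; [lia|reflexivity].
  - rewrite length_seq. rewrite Rabs_mult, (Rabs_right sg) by lra. fold x.
    destruct n as [|n]; [lia|]. replace (S n - 1)%nat with n by lia. cbn [pow].
    rewrite <- (Rmult_assoc _ (INR M)). apply Rmult_le_compat_r; [apply pow_le; lra|].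
    (* Since [INR M * sg = s], the factor [INR M] missing from the number of lines comes out; what
       remains decreases in [x], so [h] may replace it. *)
    replace ((INR M * (sg * x) + 3) * (3 * (eta / (sg * x))))
      with (3 * eta * (1 + 3 / (s * x)) * INR M) by (unfold sg; field; repeat split; lra).
    assert (Heta0 : 0 < eta) by lra.
    apply Rmult_le_compat_r; [lra|]. apply Rmult_le_compat_l; [lra|].
    apply Rplus_le_compat_l. unfold Rdiv. apply Rmult_le_compat_l; [lra|].
    apply Rinv_le_contravar; nra.
Qed.

Definition hits (m n : nat) (eta : R) (theta : mat) (q : nat -> Z) : Prop :=
  forall j, (j < m)%nat -> near_int eta (sumR n (fun r => theta j r * IZR (q r))).

(** The rows of the matrix vary independently, whence the [m]-th power. *)
Lemma count_hits (m n r0 M : nat) (a : mat) (q : nat -> Z) (s eta h : R) :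
  (r0 < n)%nat -> (0 < M)%nat -> 0 < s -> 0 < h <= Rabs (IZR (q r0)) ->
  s / INR M * Rabs (IZR (q r0)) <= eta -> eta <= / 2 ->
  count (fun w => hits m n eta (fun j r => a j r + s / INR M * INR (entry w j r)) q)
    (grid m n M) <= (3 * eta * (1 + 3 / (s * h))) ^ m * (INR M ^ n) ^ m.
Proof.
  intros Hr HM Hs Hh Heta Heta2. rewrite <- Rpow_mult_distr. unfold hits, entry, grid.
  apply (count_words_all (words (seq 0 M) n) [] m
    (fun j w => near_int eta
           (sumR n (fun r => (a j r + s / INR M * INR (nth r w 0%nat)) * IZR (q r))))).
  intros j _. now apply count_row with r0.
Qed.

Definition zrange (h : nat) : list Z :=
  map (fun i => (Z.of_nat i - Z.of_nat h)%Z) (seq 0 (2 * h + 1)).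

Lemma zrange_length h : length (zrange h) = (2 * h + 1)%nat.
Proof. unfold zrange. now rewrite length_map, length_seq. Qed.

Lemma in_zrange h z : In z (zrange h) <-> (Z.abs z <= Z.of_nat h)%Z.
Proof.
  unfold zrange. rewrite in_map_iff. split.
  - intros (i & <- & Hi). apply in_seq in Hi. lia.
  - intros Hz. exists (Z.to_nat (z + Z.of_nat h)). split; [lia|]. apply in_seq. lia.
Qed.

(** Union bound over the [(2 * K + 1) ^ n] vectors [q]. The parameters [K] and [h] are separate
    because large and small [q] are treated with different values of both. *)
Lemma count_hits_range (m n M K : nat) (a : mat) (s eta h : R) (H : nat) :
  (0 < M)%nat -> 0 < s -> 0 < h -> s / INR M * INR H <= eta -> 0 < eta <= / 2 -> (K <= H)%nat ->
  count (fun w => exists q, (forall r, (r < n)%nat -> (Z.abs (q r) <= Z.of_nat K)%Z) /\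
                    (exists r, (r < n)%nat /\ h <= Rabs (IZR (q r))) /\
                    hits m n eta (fun j r => a j r + s / INR M * INR (entry w j r)) q)
    (grid m n M)
  <= INR (2 * K + 1) ^ n * ((3 * eta * (1 + 3 / (s * h))) ^ m * (INR M ^ n) ^ m).
Proof.
  intros HM Hs Hh Heta Heta2 HKH.
  assert (HM' : 0 < INR M) by now apply lt_0_INR.
  rewrite <- (zrange_length K), <- pow_INR, <- words_length.
  apply count_union with (S := fun qw w =>
     (exists r, (r < n)%nat /\ h <= Rabs (IZR (nth r qw 0%Z))) /\
     hits m n eta (fun j r => a j r + s / INR M * INR (entry w j r)) (fun r => nth r qw 0%Z)).
  - intros w _ (q & Hq & (r & Hr & Hqr) & Hhit).
    assert (En : forall r', (r' < n)%nat -> nth r' (map q (seq 0 n)) 0%Z = q r').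
    { intros r' Hr'. rewrite (nth_indep _ _ (q 0%nat)) by (rewrite length_map, length_seq; lia).
      rewrite map_nth, seq_nth by lia. reflexivity. }
    exists (map q (seq 0 n)). split; [|split].
    + apply in_words. rewrite length_map, length_seq. split; [reflexivity|].
      intros z Hz. apply in_map_iff in Hz as (r' & <- & Hr'). apply in_seq in Hr'.
      apply in_zrange, Hq. lia.
    + exists r. now rewrite En.
    + intros j Hj. rewrite (sumR_ext _ _ (fun r' => (a j r' + s / INR M * INR (entry w j r')) * IZR (q r'))).
      * now apply Hhit.
      * intros r' Hr'. now rewrite En.
  - intros qw Hqw. apply in_words in Hqw as [Hl Hqw].
    destruct (classic (exists r, (r < n)%nat /\ h <= Rabs (IZR (nth r qw 0%Z)))) as [(r & Hr & Hqr)|Hno].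
    + eapply Rle_trans; [|apply (count_hits m n r M a (fun r => nth r qw 0%Z) s eta h); auto; try lra].
      * apply count_le. tauto.
      * eapply Rle_trans; [|exact Heta]. apply Rmult_le_compat_l; [apply Rlt_le, Rdiv_lt_0_compat; lra|].
        rewrite <- abs_IZR, INR_IZR_INZ. apply IZR_le.
        assert (In (nth r qw 0%Z) (zrange K)) as HIn by (apply Hqw, nth_In; lia).
        apply in_zrange in HIn. lia.
    + rewrite count_none by tauto.
      assert (0 < 3 / (s * h)) by (apply Rdiv_lt_0_compat; nra).
      apply Rmult_le_pos; apply pow_le; [nra|]. apply pow_le; lra.
Qed.

(* The factor 24 makes the main term at most 1/4; the nonzero [q] below [3 / s],
   for which the points [theta q] do not wrap around often enough, are finitely many. *)
Lemma count_bad (m n : nat) (a : mat) (s : R) :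
  (0 < m)%nat -> (0 < n)%nat -> 0 < s ->
  exists T0, forall T H M : nat,
    (T0 <= T)%nat -> (0 < T)%nat -> (24 * H = T ^ m)%nat -> (0 < M)%nat ->
    s / INR M <= / INR T ^ (m + n) ->
    count (fun w => bad m n H (/ (24 * INR T ^ n))
                      (fun j r => a j r + s / INR M * INR (entry w j r)))
      (grid m n M) <= / 2 * (INR M ^ n) ^ m.
Proof.
  intros Hm Hn Hs.
  (* Beyond [H1] the factor [1 + 3 / (s * h)] is at most 2; [g] is three times its value at [h = 1],
     used for the small vectors. *)
  destruct (archimed_nat (3 / s)) as [H1 HH1].
  set (g := 3 * (1 + 3 / s)).
  assert (Hs3 : 0 < 3 / s) by (apply Rdiv_lt_0_compat; lra).
  set (P := INR (2 * H1 + 1) ^ n).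
  assert (HP : 1 <= P).
  { unfold P. apply pow_R1_Rle. rewrite plus_INR, mult_INR. simpl. pose proof (pos_INR H1). lra. }
  (* The first bound limits the proportion of cells hit by the at most [P] small vectors to [/ 24];
     the second gives [H1 + 1 <= H]. *)
  destruct (archimed_nat (Rmax (g * P) (INR (24 * (H1 + 1))))) as [T0 HT0].
  exists T0. intros T H M HT HTpos HH HM Hsg.
  specialize (HT0 T HT).
  assert (HT1 : g * P <= INR T) by (eapply Rle_trans; [apply Rmax_l|exact HT0]).
  assert (HT2 : INR (24 * (H1 + 1)) <= INR T) by (eapply Rle_trans; [apply Rmax_r|exact HT0]).
  apply INR_le in HT2.
  assert (HTR : 1 <= INR T) by (replace 1 with (INR 1) by reflexivity; apply le_INR; lia).
  assert (HTm : (T <= T ^ m)%nat).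
  { replace T with (T ^ 1)%nat at 1 by apply Nat.pow_1_r. apply Nat.pow_le_mono_r; lia. }
  assert (HTn : INR T <= INR T ^ n).
  { replace (INR T) with (INR T ^ 1) at 1 by ring. apply Rle_pow; [exact HTR|lia]. }
  assert (HH' : INR H = INR T ^ m / 24).
  { rewrite <- pow_INR, <- HH, mult_INR. simpl. field. }
  assert (H1H : (H1 + 1 <= H)%nat) by lia.
  set (eta := / (24 * INR T ^ n)).
  assert (Hpn : 0 < INR T ^ n) by lra.
  assert (Hpm : 0 < INR T ^ m) by (apply pow_lt; lra).
  assert (Heta : 0 < eta <= / 24).
  { unfold eta. split; [apply Rinv_0_lt_compat; lra|]. apply Rinv_le_contravar; lra. }
  assert (HsH : s / INR M * INR H <= eta).
  { eapply Rle_trans; [apply Rmult_le_compat_r; [apply pos_INR|exact Hsg]|].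
    rewrite HH', pow_add. unfold eta. right. field. split; apply Rgt_not_eq; lra. }
  set (G := (INR M ^ n) ^ m).
  assert (HG : 0 <= G) by (apply pow_le, pow_le, pos_INR).
  (* Vectors with an entry beyond [H1], and nonzero vectors within [H1], are allotted a quarter of
     the cells each. *)
  apply Rle_trans with (/ 4 * G + / 4 * G); [|lra].
  pose (B := fun K h w => exists q, (forall r, (r < n)%nat -> (Z.abs (q r) <= Z.of_nat K)%Z) /\
                    (exists r, (r < n)%nat /\ h <= Rabs (IZR (q r))) /\
                    hits m n eta (fun j r => a j r + s / INR M * INR (entry w j r)) q).
  apply Rle_trans with (count (B H (INR (H1 + 1))) (grid m n M) + count (B H1 1) (grid m n M));
    [|apply Rplus_le_compat].
  - eapply Rle_trans; [|apply (count_or (B H (INR (H1 + 1))) (B H1 1))]. apply count_le.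
    intros w _ (q & p & (r & Hr & Hqr) & HqH & Hlin).
    assert (Hh : hits m n eta (fun j r => a j r + s / INR M * INR (entry w j r)) q).
    { intros j Hj. exists (p j). now apply Hlin. }
    destruct (classic (exists r, (r < n)%nat /\ INR (H1 + 1) <= Rabs (IZR (q r)))) as [Hbig|Hsmall].
    + left. exists q. split; [exact HqH|]. split; [exact Hbig|exact Hh].
    + right. exists q. split; [|split; [|exact Hh]].
      * intros r' Hr'.
        destruct (Z_le_gt_dec (Z.abs (q r')) (Z.of_nat H1)) as [Hle|Hgt]; [exact Hle|].
        exfalso. apply Hsmall. exists r'. split; [exact Hr'|].
        rewrite <- abs_IZR, INR_IZR_INZ. apply IZR_le. lia.
      * exists r. split; [exact Hr|].
        rewrite <- abs_IZR. apply IZR_le. lia.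
  - eapply Rle_trans; [apply (count_hits_range m n M H a s eta (INR (H1 + 1)) H); auto; try lra|].
    + apply lt_0_INR. lia.
    + fold G. rewrite <- Rmult_assoc. apply Rmult_le_compat_r; [exact HG|].
      assert (Hh : 3 / (s * INR (H1 + 1)) <= 1).
      { specialize (HH1 (H1 + 1)%nat ltac:(lia)).
        assert (0 < INR (H1 + 1)) by (apply lt_0_INR; lia).
        apply Rmult_le_reg_r with (s * INR (H1 + 1)); [nra|].
        apply (Rmult_le_compat_l s) in HH1; [|lra].
        replace (s * (3 / s)) with 3 in HH1 by (field; lra).
        replace (3 / (s * INR (H1 + 1)) * (s * INR (H1 + 1))) with 3 by (field; lra). lra. }
      (* With [H = T ^ m / 24] and [eta = / (24 * T ^ n)] the powers of [T] cancel, leaving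
         [(/ 8) ^ n * (/ 4) ^ m]. *)
      apply Rle_trans with ((3 * INR H) ^ n * (6 * eta) ^ m).
      * assert (HHR : 1 <= INR H) by (replace 1 with (INR 1) by reflexivity; apply le_INR; lia).
        assert (0 < 3 / (s * INR (H1 + 1))).
        { apply Rdiv_lt_0_compat; [lra|]. apply Rmult_lt_0_compat; [lra|]. apply lt_0_INR. lia. }
        apply Rmult_le_compat; try (apply pow_le); try apply pos_INR.
        -- nra.
        -- apply pow_incr. split; [apply pos_INR|]. rewrite plus_INR, mult_INR. simpl. lra.
        -- apply pow_incr. split; nra.
      * rewrite HH'. unfold eta.
        replace (3 * (INR T ^ m / 24)) with (/ 8 * INR T ^ m) by field.
        replace (6 * / (24 * INR T ^ n)) with (/ 4 * / INR T ^ n) by (field; lra).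
        rewrite !Rpow_mult_distr, (pow_inv (INR T ^ n)), <- !pow_mult, (Nat.mul_comm n m).
        assert (A0 : INR T ^ (m * n) <> 0) by (apply pow_nonzero; lra).
        replace ((/ 8) ^ n * INR T ^ (m * n) * ((/ 4) ^ m * / INR T ^ (m * n)))
          with ((/ 8) ^ n * (/ 4) ^ m) by (field; exact A0).
        assert (A1 := pow_le_1_self (/ 8) n ltac:(lra) Hn).
        assert (A2 := pow_le_1_self (/ 4) m ltac:(lra) Hm).
        assert (A3 : 0 <= (/ 8) ^ n) by (apply pow_le; lra).
        assert (A4 : 0 <= (/ 4) ^ m) by (apply pow_le; lra).
        nra.
  - eapply Rle_trans; [apply (count_hits_range m n M H1 a s eta 1 H); auto; try lra; lia|].
    fold G. rewrite <- Rmult_assoc. apply Rmult_le_compat_r; [exact HG|].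
    fold P. rewrite Rmult_1_r.
    replace (3 * eta * (1 + 3 / s)) with (g * eta) by (unfold g; ring).
    assert (Hg : 3 <= g) by (unfold g; lra).
    assert (HgP : g * P * eta <= / 24).
    { unfold eta. apply Rmult_le_reg_r with (24 * INR T ^ n); [lra|].
      rewrite Rmult_assoc, Rinv_l by lra. lra. }
    assert (Hge : (g * eta) ^ m <= g * eta) by (apply pow_le_1_self; [nra|exact Hm]).
    apply Rle_trans with (P * (g * eta)); [apply Rmult_le_compat_l; lra|]. nra.
Qed.

(** * Inhomogeneous approximation off the bad set *)

Lemma lin_form_plus (m n : nat) (theta : mat) (q q' p p' : nat -> Z) (j : nat) :
  lin_form m n theta (fun r => q r + q' r)%Z (fun i => p i + p' i)%Z j
  = lin_form m n theta q p j + lin_form m n theta q' p' j.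
Proof.
  unfold lin_form. rewrite plus_IZR.
  rewrite (sumR_ext _ _ (fun r => theta j r * IZR (q r) + theta j r * IZR (q' r)))
    by (intros; rewrite plus_IZR; ring).
  rewrite sumR_plus. ring.
Qed.

Lemma lin_form_scal (m n : nat) (theta : mat) (q p : nat -> Z) (z : Z) (j : nat) :
  lin_form m n theta (fun r => z * q r)%Z (fun i => z * p i)%Z j
  = IZR z * lin_form m n theta q p j.
Proof.
  unfold lin_form. rewrite mult_IZR.
  rewrite (sumR_ext _ _ (fun r => IZR z * (theta j r * IZR (q r))))
    by (intros; rewrite mult_IZR; ring).
  rewrite sumR_scal. ring.
Qed.

Lemma lin_form_0 (m n : nat) (theta : mat) (j : nat) :
  lin_form m n theta (fun _ => 0%Z) (fun _ => 0%Z) j = 0.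
Proof.
  unfold lin_form. rewrite (sumR_ext _ _ (fun r => 0 * theta j r)) by (intros; ring).
  rewrite sumR_scal. ring.
Qed.

(** The inhomogeneous problem with target [- w]. Both tolerances are linear in the level [k], so
    that levels add when solutions are added. *)
Definition reach (m n H : nat) (eta : R) (theta : mat) (k : nat) (w : nat -> R) : Prop :=
  exists q p : nat -> Z,
    (forall r, (r < n)%nat -> (Z.abs (q r) <= Z.of_nat (k * H))%Z) /\
    (forall j, (j < m)%nat -> Rabs (w j + lin_form m n theta q p j) <= INR k * eta).

Lemma reach_S (m n H : nat) (eta : R) (theta : mat) (k : nat) (w w' : nat -> R) (q p : nat -> Z) :
  reach m n H eta theta k w ->
  (forall r, (r < n)%nat -> (Z.abs (q r) <= Z.of_nat H)%Z) ->
  (forall j, (j < m)%nat -> Rabs (w' j - w j + lin_form m n theta q p j) <= eta) ->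
  reach m n H eta theta (S k) w'.
Proof.
  intros (q0 & p0 & Hq0 & Hp0) Hq Hp.
  exists (fun r => q r + q0 r)%Z, (fun i => p i + p0 i)%Z. split.
  - intros r Hr. specialize (Hq r Hr). specialize (Hq0 r Hr). simpl. lia.
  - intros j Hj. rewrite lin_form_plus, S_INR.
    specialize (Hp j Hj). specialize (Hp0 j Hj).
    replace (w' j + (lin_form m n theta q p j + lin_form m n theta q0 p0 j))
      with ((w' j - w j + lin_form m n theta q p j) + (w j + lin_form m n theta q0 p0 j)) by ring.
    eapply Rle_trans; [apply Rabs_triang|]. lra.
Qed.

Lemma reach_mono (m n H : nat) (eta : R) (theta : mat) (k k' : nat) (w : nat -> R) :
  0 <= eta -> (k <= k')%nat -> reach m n H eta theta k w -> reach m n H eta theta k' w.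
Proof.
  intros He Hk (q & p & Hq & Hp). exists q, p. split.
  - intros r Hr. specialize (Hq r Hr). nia.
  - intros j Hj. eapply Rle_trans; [now apply Hp|].
    apply Rmult_le_compat_r; [exact He|now apply le_INR].
Qed.

Lemma eventually_forall (K : nat) (P : nat -> nat -> Prop) :
  (forall k, (k < K)%nat -> exists S, forall S', (S <= S')%nat -> P k S') ->
  exists S, forall S', (S <= S')%nat -> forall k, (k < K)%nat -> P k S'.
Proof.
  induction K as [|K IH]; intros H.
  - exists 0%nat. intros; lia.
  - destruct IH as (S1 & H1); [intros; apply H; lia|].
    destruct (H K ltac:(lia)) as (S2 & H2).
    exists (S1 + S2)%nat. intros S' HS' k Hk.
    destruct (Nat.eq_dec k K) as [->|Hne]; [apply H2; lia|apply H1; lia].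
Qed.

(** Discrete continuity: walk from 0 to [w] in steps of size at most [eta]. The origin is reachable
    at every level, and the first point of the walk that is not [k]-reachable is one step away from
    a [k]-reachable one. *)
Lemma reach_levels (m n H : nat) (eta : R) (theta : mat) (K : nat) (w : nat -> R) :
  0 < eta -> ~ reach m n H eta theta K w ->
  forall k, (k <= K)%nat ->
  exists u, reach m n H eta theta (S k) u /\ ~ reach m n H eta theta k u.
Proof.
  intros He HK k Hk.
  destruct (eventually_forall m (fun j S => Rabs (w j / eta) <= INR S)) as (S0 & Hw).
  { intros j _. apply archimed_nat. }
  set (S := Datatypes.S S0). assert (HS : (0 < S)%nat) by (unfold S; lia).
  specialize (Hw S ltac:(unfold S; lia)). clearbody S.
  assert (HSR : 0 < INR S) by now apply lt_0_INR.
  set (path := fun (t : nat) (j : nat) => INR t / INR S * w j).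
  destruct (dec_inh_nat_subset_has_unique_least_element
              (fun t => ~ reach m n H eta theta k (path t))) as (t & (Ht & Hmin) & _).
  - intros; apply classic.
  - exists S. intros (q & p & Hq & Hp). apply HK, (reach_mono _ _ _ _ _ k); [lra|exact Hk|].
    exists q, p. split; [exact Hq|]. intros j Hj. specialize (Hp j Hj).
    unfold path in Hp. replace (INR S / INR S * w j) with (w j) in Hp by (field; lra). exact Hp.
  - destruct t as [|t].
    + exfalso. apply Ht. exists (fun _ => 0%Z), (fun _ => 0%Z). split; [intros; simpl; lia|].
      intros j Hj. rewrite lin_form_0. unfold path. simpl.
      replace (0 / INR S * w j + 0) with 0 by (field; lra).
      rewrite Rabs_R0. apply Rmult_le_pos; [apply pos_INR|lra].
    + exists (path (Datatypes.S t)). split; [|exact Ht].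
      apply (reach_S _ _ _ _ _ _ (path t) _ (fun _ => 0%Z) (fun _ => 0%Z)).
      * apply NNPP. intros Hn. apply Hmin in Hn. lia.
      * intros; simpl; lia.
      * intros j Hj. rewrite lin_form_0. unfold path. rewrite S_INR.
        replace ((INR t + 1) / INR S * w j - INR t / INR S * w j + 0)
          with (w j / eta * (eta / INR S)) by (field; lra).
        specialize (Hw j Hj). rewrite Rabs_mult, (Rabs_right (eta / INR S)).
        -- apply Rle_trans with (INR S * (eta / INR S)).
           ++ apply Rmult_le_compat_r; [apply Rlt_le, Rdiv_lt_0_compat; lra|exact Hw].
           ++ right. field. lra.
        -- apply Rle_ge, Rlt_le, Rdiv_lt_0_compat; lra.
Qed.

Lemma pigeonhole {A B} (f : A -> B) (l : list A) (l' : list B) :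
  NoDup l -> (forall x, In x l -> In (f x) l') -> (length l' < length l)%nat ->
  exists x y, In x l /\ In y l /\ x <> y /\ f x = f y.
Proof.
  intros Hl Hf Hlen. apply NNPP. intros Hn.
  assert (G : NoDup (map f l)).
  { apply NoDup_map_NoDup_ForallPairs; [|exact Hl].
    intros x y Hx Hy E. apply NNPP. intros Hne. apply Hn. now exists x, y. }
  apply (NoDup_incl_length (l' := l')) in G; [rewrite length_map in G; lia|].
  intros z Hz. apply in_map_iff in Hz as (x & <- & Hx). auto.
Qed.

Lemma NoDup_list_prod {A B} (l : list A) (l' : list B) :
  NoDup l -> NoDup l' -> NoDup (list_prod l l').
Proof.
  intros Hl Hl'. induction Hl as [|x l Hx Hl IH]; simpl; [constructor|].
  apply NoDup_app; [|exact IH|].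
  - apply Injective_map_NoDup; [|exact Hl']. intros y y' E. now injection E.
  - intros z Hz Hz'. apply in_map_iff in Hz as (y & <- & _).
    apply in_prod_iff in Hz' as [Hx' _]. contradiction.
Qed.

(** Tells which of the [L] equal parts of the unit interval contains [y] modulo 1. *)
Definition cell (L : nat) (y : R) : nat := Z.to_nat (Int_part (INR L * frac_part y)).

Lemma cell_spec (L : nat) (y : R) : (0 < L)%nat ->
  (cell L y < L)%nat /\ INR (cell L y) <= INR L * frac_part y < INR (cell L y) + 1.
Proof.
  intros HL. apply lt_0_INR in HL.
  destruct (base_fp y) as [H1 H2].
  destruct (base_Int_part (INR L * frac_part y)) as [H3 H4].
  assert (H0 : (0 <= Int_part (INR L * frac_part y))%Z).
  { apply Z.lt_succ_r, lt_IZR. rewrite succ_IZR. nra. }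
  assert (E : INR (cell L y) = IZR (Int_part (INR L * frac_part y))).
  { unfold cell. now rewrite INR_IZR_INZ, Z2Nat.id. }
  rewrite E. split; [|lra]. apply INR_lt. rewrite E. nra.
Qed.

Lemma cell_eq (L : nat) (y y' : R) : (0 < L)%nat -> cell L y = cell L y' ->
  near_int (/ INR L) (y - y').
Proof.
  intros HL E. exists (Int_part y' - Int_part y)%Z.
  destruct (cell_spec L y HL) as [_ H1]. destruct (cell_spec L y' HL) as [_ H2].
  rewrite E in H1. apply lt_0_INR in HL. rewrite minus_IZR.
  replace (y - y' + (IZR (Int_part y') - IZR (Int_part y)))
    with (frac_part y - frac_part y') by (unfold frac_part; ring).
  apply Rabs_le. split.
  - apply Rmult_le_reg_l with (INR L); [lra|]. rewrite Ropp_mult_distr_r_reverse, Rinv_r; lra.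
  - apply Rmult_le_reg_l with (INR L); [lra|]. rewrite Rinv_r; lra.
Qed.

Lemma list_neq_nth (u v : list nat) :
  length u = length v -> u <> v ->
  exists r, (r < length u)%nat /\ nth r u 0%nat <> nth r v 0%nat.
Proof.
  intros Hl Hne. apply NNPP. intros Hn. apply Hne.
  apply (nth_ext _ _ 0%nat 0%nat Hl). intros r Hr. apply NNPP. intros Hr'.
  apply Hn. now exists r.
Qed.

(* Along the segment from 0 to a point that is not [2J]-reachable there are
   [J] points of levels 1, 3, 5, ...; their translates by [theta q], [0 <= q <= H],
   lie in different cells of side [1/L], because two in the same cell would
   either lower a level or give a short vector. *)
Lemma not_bad_reach (m n H L J : nat) (theta : mat) (w : nat -> R) :
  (0 < L)%nat -> (L ^ m < J * (H + 1) ^ n)%nat -> ~ bad m n H (/ INR L) theta ->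
  reach m n H (/ INR L) theta (2 * J) w.
Proof.
  intros HL HJ Hbad. apply NNPP. intros Hw.
  assert (HLR : 0 < / INR L) by now apply Rinv_0_lt_compat, lt_0_INR.
  assert (Hlev := reach_levels _ _ _ _ _ _ _ HLR Hw).
  (* The levels are two apart because one step from [u i], of level [2 * i + 1], must stay within
     level [2 * i'] when [i < i']. *)
  destruct (choice (fun i u => (i < J)%nat ->
              reach m n H (/ INR L) theta (S (2 * i)) u /\
              ~ reach m n H (/ INR L) theta (2 * i) u)) as (u & Hu).
  { intros i. destruct (Nat.lt_ge_cases i J) as [Hi|Hi].
    - destruct (Hlev (2 * i)%nat ltac:(lia)) as (x & Hx). now exists x.
    - exists (fun _ => 0). lia. }
  set (qf := fun (qw : list nat) (r : nat) => Z.of_nat (nth r qw 0%nat)).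
  set (f := fun x : nat * list nat => map (fun j => cell L
              (u (fst x) j + sumR n (fun r => theta j r * IZR (qf (snd x) r)))) (seq 0 m)).
  assert (Hcoll : forall i i' qw qw', (i <= i' < J)%nat -> f (i, qw) = f (i', qw') ->
    (i, qw) <> (i', qw') -> In qw (words (seq 0 (H + 1)) n) -> In qw' (words (seq 0 (H + 1)) n) ->
    False).
  { intros i i' qw qw' Hi E Hne Hqw Hqw'.
    apply in_words in Hqw as [Hl1 Hqw]. apply in_words in Hqw' as [Hl2 Hqw'].
    set (q := fun r => (qf qw' r - qf qw r)%Z).
    assert (Hq : forall r, (r < n)%nat -> (Z.abs (q r) <= Z.of_nat H)%Z).
    { intros r Hr. unfold q, qf.
      assert (H1 := Hqw (nth r qw 0%nat) ltac:(apply nth_In; lia)). apply in_seq in H1.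
      assert (H2 := Hqw' (nth r qw' 0%nat) ltac:(apply nth_In; lia)). apply in_seq in H2. lia. }
    destruct (choice (fun j z => (j < m)%nat ->
       Rabs (u i' j - u i j + (sumR n (fun r => theta j r * IZR (q r)) + IZR z)) <= / INR L))
      as (p & Hp).
    { intros j. destruct (Nat.lt_ge_cases j m) as [Hj|Hj]; [|exists 0%Z; lia].
      assert (Ej := ext_in_map (eq_sym E) j ltac:(apply in_seq; lia)). cbn [fst snd] in Ej.
      apply cell_eq in Ej as (z & Hz); [|exact HL]. exists z. intros _.
      replace (sumR n (fun r => theta j r * IZR (q r))) with
        (sumR n (fun r => theta j r * IZR (qf qw' r)) - sumR n (fun r => theta j r * IZR (qf qw r))).
      - match goal with |- Rabs ?y <= _ => match type of Hz with Rabs ?y' <= _ =>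
          replace y with y' by ring; exact Hz end end.
      - apply Rplus_eq_reg_r with (sumR n (fun r => theta j r * IZR (qf qw r))).
        rewrite <- sumR_plus. ring_simplify. apply sumR_ext. intros r _.
        unfold q. rewrite minus_IZR. ring. }
    destruct (Nat.eq_dec i i') as [<-|Hii].
    - apply Hbad. exists q, p. split; [|split; [exact Hq|]].
      + destruct (list_neq_nth qw qw') as (r & Hr & Hne'); [lia|congruence|].
        exists r. split; [lia|]. unfold q, qf. lia.
      + intros j Hj. specialize (Hp j Hj). unfold lin_form.
        now rewrite Rminus_diag, Rplus_0_l in Hp.
    - destruct (Hu i ltac:(lia)) as [Hr _]. destruct (Hu i' ltac:(lia)) as [_ Hnr].
      apply Hnr, (reach_mono _ _ _ _ _ (S (S (2 * i)))); [lra|lia|].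
      now apply (reach_S _ _ _ _ _ _ (u i) _ q p). }
  destruct (pigeonhole f (list_prod (seq 0 J) (words (seq 0 (H + 1)) n)) (words (seq 0 L) m))
    as ([i qw] & [i' qw'] & Hx & Hy & Hne & E).
  - apply NoDup_list_prod; [apply seq_NoDup|apply words_NoDup, seq_NoDup].
  - intros [i qw] _. apply in_words. unfold f. rewrite length_map, length_seq.
    split; [reflexivity|]. intros k Hk. apply in_map_iff in Hk as (j & <- & _).
    apply in_seq. split; [lia|]. apply cell_spec, HL.
  - rewrite length_prod, !words_length, !length_seq. exact HJ.
  - apply in_prod_iff in Hx as [Hi Hqw]. apply in_prod_iff in Hy as [Hi' Hqw'].
    apply in_seq in Hi, Hi'.
    destruct (Nat.le_ge_cases i i') as [Hle|Hle].
    + apply (Hcoll i i' qw qw'); auto; lia.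
    + apply (Hcoll i' i qw' qw); auto; lia.
Qed.

(** * A good subcube in every cell with a good corner *)

(** Substituting [q = v + N0 * (b + q')] and [p = v + N0 * p'] removes the congruences and leaves an
    inhomogeneous problem divided by [N0]. The shift [b] places [q], and [z] is the value aimed
    at. *)
Lemma congruent_approximation (m n H K N0 : nat) (eta : R) (theta : mat)
  (v b : nat -> Z) (z : nat -> R) :
  (0 < N0)%nat -> (forall w, reach m n H eta theta K w) ->
  exists p q : nat -> Z,
    (forall j, (j < m)%nat -> zcong (p j) (v j) N0) /\
    (forall r, (r < n)%nat -> zcong (q r) (v (m + r)%nat) N0) /\
    (forall r, (r < n)%nat ->
       (Z.abs (q r - v (m + r)%nat - Z.of_nat N0 * b r) <= Z.of_nat (N0 * (K * H)))%Z) /\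
    (forall j, (j < m)%nat ->
       Rabs (lin_form m n theta q p j - z j) <= INR N0 * (INR K * eta)).
Proof.
  intros HN Hr.
  assert (HN' : 0 < INR N0) by now apply lt_0_INR.
  set (q0 := fun r => (v (m + r)%nat + Z.of_nat N0 * b r)%Z).
  destruct (Hr (fun j => (lin_form m n theta q0 v j - z j) / INR N0)) as (q' & p' & Hq' & Hp').
  exists (fun j => v j + Z.of_nat N0 * p' j)%Z, (fun r => q0 r + Z.of_nat N0 * q' r)%Z.
  repeat split.
  - intros j _. exists (p' j). lia.
  - intros r _. exists (b r + q' r)%Z. unfold q0. lia.
  - intros r Hrn. specialize (Hq' r Hrn). unfold q0. rewrite Nat2Z.inj_mul.
    replace (v (m + r)%nat + Z.of_nat N0 * b r + Z.of_nat N0 * q' r - v (m + r)%nat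
             - Z.of_nat N0 * b r)%Z with (Z.of_nat N0 * q' r)%Z by ring.
    rewrite Z.abs_mul, Z.abs_eq by lia. apply Z.mul_le_mono_nonneg_l; lia.
  - intros j Hj. specialize (Hp' j Hj). rewrite lin_form_plus, lin_form_scal, <- INR_IZR_INZ.
    match type of Hp' with Rabs ?y <= _ =>
      match goal with |- Rabs ?y' <= _ => replace y' with (INR N0 * y) by (field; lra) end end.
    rewrite Rabs_mult, Rabs_right by lra. apply Rmult_le_compat_l; lra.
Qed.

Lemma lin_form_perturb (m n : nat) (theta theta' : mat) (q p : nat -> Z) (j : nat) (e Q : R) :
  (forall r, (r < n)%nat -> Rabs (theta j r - theta' j r) <= e) ->
  (forall r, (r < n)%nat -> Rabs (IZR (q r)) <= Q) ->
  Rabs (lin_form m n theta q p j - lin_form m n theta' q p j) <= INR n * (e * Q).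
Proof.
  intros He HQ. unfold lin_form.
  replace (sumR n (fun r => theta j r * IZR (q r)) + IZR (p j)
           - (sumR n (fun r => theta' j r * IZR (q r)) + IZR (p j)))
    with (sumR n (fun r => (theta j r - theta' j r) * IZR (q r))).
  - apply sumR_abs_le. intros r Hr. rewrite Rabs_mult.
    apply Rmult_le_compat; auto using Rabs_pos.
  - apply Rplus_eq_reg_r with (sumR n (fun r => theta' j r * IZR (q r))).
    rewrite <- sumR_plus. ring_simplify. apply sumR_ext. intros; ring.
Qed.

Lemma common_multiple (K : nat) (f : nat -> nat) :
  (forall k, (k < K)%nat -> (0 < f k)%nat) ->
  exists N0, (0 < N0)%nat /\ forall k, (k < K)%nat -> exists c, N0 = (c * f k)%nat.
Proof.
  induction K as [|K IH]; intros H.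
  - exists 1%nat. split; [lia|]. intros; lia.
  - destruct IH as (N1 & HN1 & Hd); [intros; apply H; lia|].
    assert (HK := H K ltac:(lia)).
    exists (N1 * f K)%nat. split; [nia|]. intros k Hk.
    destruct (Nat.eq_dec k K) as [->|Hne]; [now exists N1|].
    destruct (Hd k ltac:(lia)) as (c & ->). exists (c * f K)%nat. ring.
Qed.

(** Lets one modulus serve all pairs and coordinates, as congruence modulo a multiple implies the
    one required. *)
Lemma common_modulus (l d : nat) (N : nat -> nat -> nat) :
  (forall i k, (i < l)%nat -> (k < d)%nat -> (0 < N i k)%nat) ->
  exists N0, (0 < N0)%nat /\
    forall i k, (i < l)%nat -> (k < d)%nat -> exists c, N0 = (c * N i k)%nat.
Proof.
  intros H.
  destruct (choice (fun i N1 => (i < l)%nat -> (0 < N1)%nat /\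
     forall k, (k < d)%nat -> exists c, N1 = (c * N i k)%nat)) as (f & Hf).
  { intros i. destruct (Nat.lt_ge_cases i l) as [Hi|Hi]; [|exists 0%nat; lia].
    destruct (common_multiple d (N i)) as (N1 & HN1); [now auto|]. now exists N1. }
  destruct (common_multiple l f) as (N0 & HN0 & Hd); [intros; now apply Hf|].
  exists N0. split; [exact HN0|]. intros i k Hi Hk.
  destruct (Hd i Hi) as (c & ->). destruct (Hf i Hi) as [_ G].
  destruct (G k Hk) as (c' & ->). exists (c * c')%nat. ring.
Qed.

Lemma zcong_dvd (x v : Z) (N c : nat) : zcong x v (c * N) -> zcong x v N.
Proof. intros (k & Hk). exists (k * Z.of_nat c)%Z. rewrite Hk. lia. Qed.

(** After multiplication by [Q ^ n] the right side is [c * Q ^ g] with [g = (1 - delta) * n],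
    unbounded because [delta < 1]. Explicitly, [Q ^ g >= g * ln Q] by [exp x >= x]. *)
Lemma power_gain (D c delta : R) (n : nat) : 0 < c -> delta < 1 -> (0 < n)%nat ->
  exists Q1, forall Q : nat, (Q1 <= Q)%nat -> (0 < Q)%nat ->
    D / INR Q ^ n <= c * Rpower (INR Q) (- (delta * INR n)).
Proof.
  intros Hc Hd Hn. apply lt_0_INR in Hn.
  set (g := (1 - delta) * INR n). assert (Hg : 0 < g) by (unfold g; nra).
  destruct (archimed_nat (exp (D / c / g))) as (Q1 & HQ1). exists Q1. intros Q HQ HQ0.
  specialize (HQ1 Q HQ). apply lt_0_INR in HQ0.
  replace (- (delta * INR n)) with (g + - INR n) by (unfold g; ring).
  rewrite Rpower_plus, Rpower_Ropp, Rpower_pow by exact HQ0.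
  unfold Rdiv. rewrite <- Rmult_assoc. apply Rmult_le_compat_r.
  { apply Rlt_le, Rinv_0_lt_compat, pow_lt, HQ0. }
  assert (Hln : D / c / g <= ln (INR Q)).
  { rewrite <- (ln_exp (D / c / g)).
    destruct HQ1 as [Hlt|<-]; [|lra]. apply Rlt_le, ln_increasing; [apply exp_pos|exact Hlt]. }
  assert (He : D / c <= Rpower (INR Q) g).
  { unfold Rpower. apply (Rmult_le_compat_l g) in Hln; [|lra].
    replace (g * (D / c / g)) with (D / c) in Hln by (field; lra).
    assert (A1 : forall x, x <= exp x).
    { intros x. destruct (Req_dec x 0) as [->|Hx]; [rewrite exp_0; lra|].
      assert (A2 := exp_ineq1 x Hx). lra. }
    eapply Rle_trans; [exact Hln|apply A1]. }
  apply (Rmult_le_compat_l c) in He; [|lra].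
  replace (c * (D / c)) with D in He by (field; lra). exact He.
Qed.

Lemma subdivide (x s : R) (M : nat) : (0 < M)%nat -> 0 <= x <= s ->
  exists k, (k < M)%nat /\ s / INR M * INR k <= x <= s / INR M * INR k + s / INR M.
Proof.
  intros HM Hx. assert (HM' : 0 < INR M) by now apply lt_0_INR.
  destruct (dec_inh_nat_subset_has_unique_least_element
     (fun k => x <= s / INR M * INR k + s / INR M)) as (k & (Hk & Hmin) & _).
  - intros; apply classic.
  - exists (M - 1)%nat. rewrite minus_INR by lia. simpl (INR 1).
    replace (s / INR M * (INR M - 1) + s / INR M) with s by (field; lra). lra.
  - exists k. split; [|split; [|exact Hk]].
    + assert (k <= M - 1)%nat; [|lia]. apply Hmin. rewrite minus_INR by lia. simpl (INR 1).
      replace (s / INR M * (INR M - 1) + s / INR M) with s by (field; lra). lra.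
    + destruct k as [|k]; [simpl; lra|].
      apply Rnot_lt_le. intros Hlt. assert (S k <= k)%nat; [|lia].
      apply Hmin. rewrite S_INR in Hlt. lra.
Qed.

Lemma grid_entry (m n M : nat) (k : nat -> nat -> nat) :
  (forall j r, (j < m)%nat -> (r < n)%nat -> (k j r < M)%nat) ->
  exists w, In w (grid m n M) /\
    forall j r, (j < m)%nat -> (r < n)%nat -> entry w j r = k j r.
Proof.
  intros H. exists (map (fun j => map (k j) (seq 0 n)) (seq 0 m)). split.
  - apply in_words. rewrite length_map, length_seq. split; [reflexivity|].
    intros u Hu. apply in_map_iff in Hu as (j & <- & Hj). apply in_seq in Hj.
    apply in_words. rewrite length_map, length_seq. split; [reflexivity|].
    intros t Ht. apply in_map_iff in Ht as (r & <- & Hr). apply in_seq in Hr.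
    apply in_seq. split; [lia|]. apply H; lia.
  - intros j r Hj Hr. unfold entry.
    rewrite (nth_indep _ _ (map (k 0%nat) (seq 0 n))) by (rewrite length_map, length_seq; exact Hj).
    rewrite (map_nth (fun j => map (k j) (seq 0 n))), seq_nth by exact Hj.
    rewrite (nth_indep _ _ (k (0 + j)%nat 0%nat)) by (rewrite length_map, length_seq; exact Hr).
    now rewrite map_nth, seq_nth.
Qed.

Definition approximable (m n : nat) (c delta : R) (l : nat) (N : nat -> nat -> nat)
  (v : nat -> nat -> Z) (theta : mat) (Q : nat) : Prop :=
  exists (p q : nat -> nat -> Z),
    (forall i, (i < l)%nat -> supnorm n (fun r => IZR (q i r)) <= INR Q) /\
    ((0 < l)%nat ->
       supnorm m (lin_form m n theta (q 0%nat) (p 0%nat)) ^ m <= c / (INR Q ^ n)) /\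
    (forall i, (1 <= i)%nat -> (i < l)%nat ->
       supnorm m (lin_form m n theta (q i) (p i)) ^ m
         <= c * Rpower (INR Q) (- (delta * INR n))) /\
    (forall i, (i < l)%nat ->
       (forall j, (j < m)%nat -> zcong (p i j) (v i j) (N i j)) /\
       (forall r, (r < n)%nat -> zcong (q i r) (v i (m + r)%nat) (N i (m + r)%nat))).

Definition in_cube (m n : nat) (a : mat) (s : R) (theta : mat) : Prop :=
  in_box m n a (fun j r => a j r + s) theta.

(** Here [s] is the side of a cell, not of the subdivided cube with corner [a]. *)
Definition subcube (a : mat) (s : R) (w : list (list nat)) : mat :=
  fun j r => a j r + s * INR (entry w j r).

(* In a cube of side comparable to [T^-(m+n)], moving the first column of its
   corner by at most the side annihilates the first form, whose [q] has a large
   first coordinate; a subcube of proportional size around the new point works. *)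
Lemma good_subcube (m n : nat) (c delta : R) (l : nat) (N : nat -> nat -> nat)
  (v : nat -> nat -> Z) :
  (0 < m)%nat -> (0 < n)%nat -> 0 < c -> delta < 1 ->
  (forall i k, (i < l)%nat -> (k < m + n)%nat -> (0 < N i k)%nat) ->
  exists M2, (0 < M2)%nat /\ forall Q0, exists T0, forall T H : nat,
    (T0 <= T)%nat -> (24 * H = T ^ m)%nat -> forall (a : mat) (s : R),
    / 2 * / INR T ^ (m + n) <= s <= / INR T ^ (m + n) ->
    ~ bad m n H (/ (24 * INR T ^ n)) a ->
    exists w, In w (grid m n M2) /\
      forall theta, in_cube m n (subcube a (s / INR M2) w) (s / INR M2) theta ->
        exists Q, (Q0 < Q)%nat /\ approximable m n c delta l N v theta Q.
Proof.
  intros Hm Hn Hc Hdelta HN.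
  destruct (common_modulus l (m + n) N HN) as (N0 & HN0 & Hdiv).
  destruct (eventually_forall l (fun i V => forall k, (k < m + n)%nat ->
              (Z.abs (v i k) <= Z.of_nat V)%Z)) as (V & HV).
  { intros i _. apply eventually_forall. intros k _.
    exists (Z.to_nat (Z.abs (v i k))). intros; lia. }
  (* Chosen so that [J * H ^ n = (24 * T ^ n) ^ m] when [24 * H = T ^ m]; with [H + 1] in place of
     [H] the pigeonhole inequality is strict. *)
  set (J := (24 ^ (m + n))%nat).
  assert (HJ0 : (0 < J)%nat) by (apply Nat.neq_0_lt_0, Nat.pow_nonzero; lia).
  set (K := (2 * J)%nat).
  (* From [5 * K] the deviation of [q] from its centre takes away one [K], leaving the [4 * K]
     wanted below; the 1 absorbs the residue [v], bounded by [X]. *)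
  set (B := (5 * K + 1)%nat).
  (* All [q] built below are bounded by [C * X], which becomes [Q]; [E * Y] will bound the forms
     other than the first. *)
  set (C := (1 + N0 * B + N0 * K)%nat).
  set (E := INR N0 * INR K + INR n * INR C).
  assert (HC0 : (0 < C)%nat) by (unfold C; lia).
  assert (HCR : 0 < INR C) by now apply lt_0_INR.
  assert (HNR : 0 < INR N0) by now apply lt_0_INR.
  assert (HKR : 0 < INR K) by (apply lt_0_INR; unfold K; lia).
  assert (HnR : 0 < INR n) by now apply lt_0_INR.
  (* The bound [c1 * Y] on the first form yields (2) for [Q = C * X]; the 1 ensures
     [c1 ^ m <= c1]. *)
  set (c1 := Rmin 1 (c / INR C ^ n)).
  assert (HCn : 0 < INR C ^ n) by now apply pow_lt.
  assert (Hc1 : 0 < c1).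
  { unfold c1. apply Rmin_glb_lt; [lra|]. now apply Rdiv_lt_0_compat. }
  destruct (archimed_nat (INR n * INR C / c1)) as (M1 & HM1).
  set (M2 := S M1). specialize (HM1 M2 ltac:(unfold M2; lia)).
  assert (HM2 : (0 < M2)%nat) by (unfold M2; lia).
  assert (HM2R : 0 < INR M2) by now apply lt_0_INR.
  assert (HM2c : INR n * INR C / INR M2 <= c1).
  { apply Rmult_le_reg_r with (INR M2); [exact HM2R|].
    apply (Rmult_le_compat_l c1) in HM1; [|lra].
    replace (c1 * (INR n * INR C / c1)) with (INR n * INR C) in HM1 by (field; lra).
    replace (INR n * INR C / INR M2 * INR M2) with (INR n * INR C) by (field; lra). exact HM1. }
  destruct (power_gain (E ^ m * INR C ^ n) c delta n Hc Hdelta Hn) as (Q1 & HQ1).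
  (* As [T <= X <= Q], this threshold gives [V <= X], [Q0 < Q] and [Q1 <= Q]. *)
  exists M2. split; [exact HM2|]. intros Q0. exists (1 + V + Q0 + Q1)%nat.
  intros T H HT HH a s Hs Hbad.
  assert (HTX : (T <= T ^ m)%nat).
  { replace T with (T ^ 1)%nat at 1 by apply Nat.pow_1_r. apply Nat.pow_le_mono_r; lia. }
  set (X := (T ^ m)%nat) in *.
  assert (HTR : 1 <= INR T) by (replace 1 with (INR 1) by reflexivity; apply le_INR; lia).
  assert (HXR : 0 < INR X) by (apply lt_0_INR; lia).
  assert (HTn : 1 <= INR T ^ n) by now apply pow_R1_Rle.
  set (Y := / INR T ^ n).
  assert (HY : 0 < Y) by (apply Rinv_0_lt_compat; lra).
  assert (HYX : Y ^ m = / INR X ^ n).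
  { unfold Y, X. rewrite pow_INR, pow_inv, <- !pow_mult. now rewrite Nat.mul_comm. }
  assert (HsYX : / INR T ^ (m + n) = Y / INR X).
  { unfold Y, X. rewrite pow_INR, pow_add, Rinv_mult. unfold Rdiv. ring. }
  rewrite HsYX in Hs.
  assert (HYX0 : 0 < Y / INR X) by now apply Rdiv_lt_0_compat.
  assert (Hreach : forall w, reach m n H (/ (24 * INR T ^ n)) a K w).
  { assert (EL : 24 * INR T ^ n = INR (24 * T ^ n)) by (rewrite mult_INR, pow_INR; simpl; ring).
    rewrite EL in *. intros w. apply not_bad_reach; auto.
    - assert (T ^ n <> 0)%nat by (apply Nat.pow_nonzero; lia). lia.
    - apply Nat.le_lt_trans with (J * H ^ n)%nat.
      + unfold J. rewrite Nat.pow_add_r, <- Nat.mul_assoc, <- Nat.pow_mul_l, HH. unfold X.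
        rewrite Nat.pow_mul_l, <- !Nat.pow_mul_r. now rewrite (Nat.mul_comm n m).
      + apply Nat.mul_lt_mono_pos_l; [exact HJ0|]. apply Nat.pow_lt_mono_l; lia. }
  set (eta := / (24 * INR T ^ n)) in *.
  assert (Heta : 0 < eta <= Y).
  { unfold eta, Y. split; [apply Rinv_0_lt_compat; lra|]. apply Rinv_le_contravar; lra. }
  set (NKY := INR N0 * (INR K * Y)).
  assert (HNKY : INR N0 * (INR K * eta) <= NKY).
  { apply Rmult_le_compat_l; [lra|]. apply Rmult_le_compat_l; lra. }
  assert (HHX : (H <= X)%nat) by lia.
  (* Aiming the first pair at [- NKY] with precision [NKY] puts its forms between [- 2 * NKY] and 0,
     so that the shift annihilating them is nonnegative and points into the cell. *)
  destruct (choice (fun i (pq : (nat -> Z) * (nat -> Z)) => (i < l)%nat ->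
     (forall j, (j < m)%nat -> zcong (fst pq j) (v i j) N0) /\
     (forall r, (r < n)%nat -> zcong (snd pq r) (v i (m + r)%nat) N0) /\
     (forall r, (r < n)%nat -> (Z.abs (snd pq r) <= Z.of_nat (C * X))%Z) /\
     (forall j, (j < m)%nat -> Rabs (lin_form m n a (snd pq) (fst pq) j
        - (if Nat.eq_dec i 0 then - NKY else 0)) <= NKY) /\
     (i = 0%nat -> (Z.of_nat (4 * N0 * K * X) <= snd pq 0%nat)%Z)))
    as (pq & Hpq).
  { intros i. destruct (Nat.lt_ge_cases i l) as [Hi|Hi];
      [|exists (fun _ => 0%Z, fun _ => 0%Z); lia].
    destruct (congruent_approximation m n H K N0 eta a (v i)
      (fun r => if Nat.eq_dec i 0 then (if Nat.eq_dec r 0 then Z.of_nat (B * X) else 0%Z) else 0%Z)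
      (fun _ => if Nat.eq_dec i 0 then - NKY else 0) HN0 Hreach)
      as (p & q & Hp & Hq & Hqb & Hlin).
    exists (p, q). intros _. cbn [fst snd].
    assert (HVX : forall k, (k < m + n)%nat -> (Z.abs (v i k) <= Z.of_nat X)%Z).
    { intros k Hk. assert (G := HV V ltac:(lia) i Hi k Hk). lia. }
    assert (HNKH : (N0 * (K * H) <= N0 * K * X)%nat).
    { rewrite Nat.mul_assoc. now apply Nat.mul_le_mono_l. }
    assert (HCX : (C * X = X + N0 * (B * X) + N0 * K * X)%nat) by (unfold C; ring).
    split; [exact Hp|]. split; [exact Hq|]. split; [|split].
    - intros r Hr. specialize (Hqb r Hr). specialize (HVX (m + r)%nat ltac:(lia)).
      rewrite HCX. destruct (Nat.eq_dec i 0); [destruct (Nat.eq_dec r 0)|]; lia.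
    - intros j Hj. eapply Rle_trans; [now apply Hlin|exact HNKY].
    - intros ->. specialize (Hqb 0%nat Hn). specialize (HVX (m + 0)%nat ltac:(lia)).
      destruct (Nat.eq_dec 0 0) as [_|]; [|lia].
      assert (N0 * (B * X) = 5 * (N0 * K * X) + N0 * X)%nat by (unfold B; ring).
      replace (4 * N0 * K * X)%nat with (4 * (N0 * K * X))%nat by ring. nia. }
  set (p := fun i => fst (pq i)). set (q := fun i => snd (pq i)).
  (* The shift of column 0 that annihilates the first form; 0 by default when there is no pair at
     all. *)
  set (d := fun j => if Nat.eq_dec l 0 then 0
                     else - lin_form m n a (q 0%nat) (p 0%nat) j / IZR (q 0%nat 0%nat)).
  assert (Hd : forall j, (j < m)%nat -> 0 <= d j <= s).
  { intros j Hj. unfold d. destruct (Nat.eq_dec l 0) as [_|Hl]; [lra|].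
    destruct (Hpq 0%nat ltac:(lia)) as (_ & _ & _ & Hlin & Hq0).
    specialize (Hlin j Hj). specialize (Hq0 eq_refl). fold (p 0%nat) (q 0%nat) in *.
    destruct (Nat.eq_dec 0 0) as [_|]; [|lia].
    apply Rabs_le_inv in Hlin. apply IZR_le in Hq0. rewrite <- INR_IZR_INZ, !mult_INR in Hq0.
    replace (INR 4) with 4 in Hq0 by (simpl; ring).
    assert (HP : 0 < 4 * INR N0 * INR K * INR X) by (repeat apply Rmult_lt_0_compat; lra).
    split.
    - apply Rle_mult_inv_pos; lra.
    (* This quotient is half of [Y / INR X], the lower bound on [s]; the factor 4 in the size of [q]
       was chosen for it. *)
    - apply Rle_trans with (2 * NKY / (4 * INR N0 * INR K * INR X)).
      + unfold Rdiv. apply Rmult_le_compat; [lra| |lra|].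
        * apply Rlt_le, Rinv_0_lt_compat. lra.
        * apply Rinv_le_contravar; lra.
      + replace (2 * NKY / (4 * INR N0 * INR K * INR X)) with (/ 2 * (Y / INR X))
          by (unfold NKY; field; lra). lra. }
  destruct (choice (fun j k => (j < m)%nat -> (k < M2)%nat /\
     s / INR M2 * INR k <= d j <= s / INR M2 * INR k + s / INR M2)) as (kk & Hkk).
  { intros j. destruct (Nat.lt_ge_cases j m) as [Hj|Hj]; [|exists 0%nat; lia].
    destruct (subdivide (d j) s M2 HM2 (Hd j Hj)) as (k & Hk). now exists k. }
  (* Column 0 takes the part containing the shift [d j]; the other columns stay at the corner. *)
  destruct (grid_entry m n M2 (fun j r => if Nat.eq_dec r 0 then kk j else 0%nat)) as (w & Hw & Hent).
  { intros j r Hj Hr. destruct (Nat.eq_dec r 0); [now apply Hkk|exact HM2]. }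
  exists w. split; [exact Hw|]. intros theta Htheta.
  assert (Hs0 : 0 < s) by lra.
  assert (HsM : 0 < s / INR M2) by now apply Rdiv_lt_0_compat.
  (* If there is a first pair, its form vanishes at [a1], and every point of the subcube is within
     [s / INR M2] of [a1]. *)
  set (a1 := fun j r => a j r + if Nat.eq_dec r 0 then d j else 0).
  assert (Hnear1 : forall j r, (j < m)%nat -> (r < n)%nat ->
            Rabs (theta j r - a1 j r) <= s / INR M2).
  { intros j r Hj Hr. specialize (Htheta j r Hj Hr). unfold subcube in Htheta.
    rewrite Hent in Htheta by assumption. destruct (Hkk j Hj) as [_ G]. unfold a1.
    apply Rabs_le. destruct (Nat.eq_dec r 0); [|simpl (INR 0) in Htheta]; lra. }
  assert (Hnear0 : forall j r, (j < m)%nat -> (r < n)%nat -> Rabs (theta j r - a j r) <= s).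
  { intros j r Hj Hr. specialize (Htheta j r Hj Hr). unfold subcube in Htheta.
    rewrite Hent in Htheta by assumption. destruct (Hkk j Hj) as [G _].
    set (k := if Nat.eq_dec r 0 then kk j else 0%nat) in *.
    assert (Hk : (S k <= M2)%nat) by (unfold k; destruct (Nat.eq_dec r 0); lia).
    apply le_INR in Hk. rewrite S_INR in Hk.
    assert (s / INR M2 * (INR k + 1) <= s).
    { apply Rle_trans with (s / INR M2 * INR M2); [apply Rmult_le_compat_l; lra|].
      right. field. lra. }
    assert (0 <= s / INR M2 * INR k) by (apply Rmult_le_pos; [lra|apply pos_INR]).
    apply Rabs_le. lra. }
  set (Q := (C * X)%nat).
  assert (HQR : INR Q = INR C * INR X) by (unfold Q; now rewrite mult_INR).
  assert (HQX : (X <= Q)%nat) by (unfold Q; nia).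
  assert (HqQ : forall i r, (i < l)%nat -> (r < n)%nat -> Rabs (IZR (q i r)) <= INR Q).
  { intros i r Hi Hr. destruct (Hpq i Hi) as (_ & _ & Hq & _ & _).
    rewrite <- abs_IZR, INR_IZR_INZ. apply IZR_le, Hq, Hr. }
  assert (HsQ : s * INR Q <= INR C * Y).
  { rewrite HQR. apply Rle_trans with (Y / INR X * (INR C * INR X)).
    - apply Rmult_le_compat_r; [nra|lra].
    - right. field. lra. }
  exists Q. split; [lia|]. exists p, q. split; [|split; [|split]].
  - intros i Hi. apply supnorm_le; [apply pos_INR|]. intros r Hr. now apply HqQ.
  - intros Hl. destruct (Hpq 0%nat Hl) as (_ & _ & _ & _ & Hq0). specialize (Hq0 eq_refl).
    fold (q 0%nat) in Hq0.
    assert (Hq0R : 0 < IZR (q 0%nat 0%nat)).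
    { apply IZR_lt. assert (0 < K)%nat by (unfold K; lia).
      assert (0 < 4 * N0 * K * X)%nat by (repeat apply Nat.mul_pos_pos; lia). lia. }
    apply Rle_trans with ((c1 * Y) ^ m).
    + apply pow_incr. split; [apply supnorm_ge0|]. apply supnorm_le; [nra|]. intros j Hj.
      assert (Hz : lin_form m n a1 (q 0%nat) (p 0%nat) j = 0).
      { unfold lin_form.
        rewrite (sumR_update n 0 _ (fun r => a j r * IZR (q 0%nat r)) Hn).
        - unfold a1, d at 1. destruct (Nat.eq_dec 0 0) as [_|]; [|lia].
          destruct (Nat.eq_dec l 0); [lia|]. unfold lin_form. field. lra.
        - intros r Hr. unfold a1. destruct (Nat.eq_dec r 0); [contradiction|]. ring. }
      assert (G := lin_form_perturb m n theta a1 (q 0%nat) (p 0%nat) j (s / INR M2) (INR Q)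
                 ltac:(auto) ltac:(auto)).
      rewrite Hz, Rminus_0_r in G. eapply Rle_trans; [exact G|].
      apply Rle_trans with (INR n * INR C / INR M2 * Y).
      * replace (INR n * (s / INR M2 * INR Q)) with (INR n / INR M2 * (s * INR Q)) by (field; lra).
        replace (INR n * INR C / INR M2 * Y) with (INR n / INR M2 * (INR C * Y)) by (field; lra).
        apply Rmult_le_compat_l; [|exact HsQ]. apply Rlt_le. now apply Rdiv_lt_0_compat.
      * apply Rmult_le_compat_r; lra.
    + rewrite Rpow_mult_distr, HYX, HQR, Rpow_mult_distr. unfold Rdiv.
      rewrite Rinv_mult, <- Rmult_assoc. apply Rmult_le_compat_r.
      * apply Rlt_le, Rinv_0_lt_compat, pow_lt, HXR.
      * apply Rle_trans with c1; [|apply Rmin_r].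
        apply pow_le_1_self; [|exact Hm]. split; [lra|apply Rmin_l].
  - intros i Hi1 Hi. destruct (Hpq i Hi) as (_ & _ & _ & Hlin & _).
    eapply Rle_trans; [|apply HQ1; [lia|unfold Q; nia]].
    (* In [E * Y], the part [N0 * K * Y] is the error at the corner and [n * C * Y] comes from
       moving across the cell. Its [m]-th power is [E ^ m * C ^ n / Q ^ n], to which [power_gain]
       was applied. *)
    apply Rle_trans with ((E * Y) ^ m).
    + assert (HE : 0 <= E) by (unfold E; nra).
      apply pow_incr. split; [apply supnorm_ge0|]. apply supnorm_le; [nra|]. intros j Hj.
      specialize (Hlin j Hj). fold (p i) (q i) in Hlin.
      destruct (Nat.eq_dec i 0); [lia|]. rewrite Rminus_0_r in Hlin.
      assert (G := lin_form_perturb m n theta a (q i) (p i) j s (INR Q)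
                 ltac:(auto) ltac:(auto)).
      replace (lin_form m n theta (q i) (p i) j) with
        ((lin_form m n theta (q i) (p i) j - lin_form m n a (q i) (p i) j)
         + lin_form m n a (q i) (p i) j) by ring.
      eapply Rle_trans; [apply Rabs_triang|].
      apply (Rmult_le_compat_l (INR n)) in HsQ; [|lra].
      unfold E, NKY in *. lra.
    + rewrite Rpow_mult_distr, HYX, HQR, Rpow_mult_distr. right. field.
      split; apply Rgt_not_eq; [apply pow_lt|]; assumption.
  - intros i Hi. destruct (Hpq i Hi) as (Hp & Hq & _). split.
    + intros j Hj. destruct (Hdiv i j Hi ltac:(lia)) as (c' & Hc').
      apply (zcong_dvd _ _ _ c'). rewrite <- Hc'. now apply Hp.
    + intros r Hr. destruct (Hdiv i (m + r)%nat Hi ltac:(lia)) as (c' & Hc').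
      apply (zcong_dvd _ _ _ c'). rewrite <- Hc'. now apply Hq.
Qed.

(** * Covering the exceptional set *)

Fixpoint lsum {A : Type} (f : A -> R) (l : list A) : R :=
  match l with [] => 0 | x :: l' => f x + lsum f l' end.

Lemma lsum_app {A} (f : A -> R) l l' : lsum f (l ++ l') = lsum f l + lsum f l'.
Proof. induction l as [|x l IH]; simpl; [lra|rewrite IH; lra]. Qed.

Lemma lsum_scal {A} (f : A -> R) (x : R) l : lsum (fun y => x * f y) l = x * lsum f l.
Proof. induction l as [|y l IH]; simpl; [lra|rewrite IH; lra]. Qed.

Lemma count_not {A} (P : A -> Prop) l :
  count P l + count (fun x => ~ P x) l = INR (length l).
Proof.
  induction l as [|x l IH]; [simpl; lra|]. cbn [count length]. rewrite S_INR, <- IH.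
  destruct (classic (P x)) as [p|p].
  - rewrite (indicator_true (P x)), (indicator_false (~ P x)) by tauto. lra.
  - rewrite (indicator_false (P x)), (indicator_true (~ P x)) by tauto. lra.
Qed.

Lemma sumR_nth_le {A} (f : A -> R) (d : A) l (K : nat) :
  (forall x, In x l -> 0 <= f x) -> (K <= length l)%nat ->
  sumR K (fun k => f (nth k l d)) <= lsum f l.
Proof.
  revert K. induction l as [|x l IH] using rev_ind; intros K Hf HK.
  - simpl in HK. replace K with 0%nat by lia. simpl. lra.
  - rewrite length_app in HK. simpl in HK. rewrite lsum_app. simpl.
    assert (Hx : 0 <= f x) by (apply Hf, in_or_app; simpl; auto).
    assert (Hl : forall y, In y l -> 0 <= f y) by (intros; apply Hf, in_or_app; auto).
    destruct (Nat.eq_dec K (length l + 1)) as [->|Hne].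
    + rewrite Nat.add_1_r. simpl. rewrite nth_middle.
      rewrite (sumR_ext _ _ (fun k => f (nth k l d)))
        by (intros; rewrite app_nth1 by lia; reflexivity).
      specialize (IH (length l) Hl ltac:(lia)). lra.
    + rewrite (sumR_ext _ _ (fun k => f (nth k l d)))
        by (intros; rewrite app_nth1 by lia; reflexivity).
      specialize (IH K Hl ltac:(lia)). lra.
Qed.

Definition volume (m n : nat) (C : mat * R) : R := (snd C ^ n) ^ m.

(** Cubes rather than boxes, and of positive side, so that the covering step can be applied again to
    each member. *)
Definition cube_cover (m n : nat) (S : mat -> Prop) (V : R) : Prop :=
  exists l : list (mat * R),
    (forall C, In C l -> 0 < snd C) /\
    (forall theta, S theta -> exists C, In C l /\ in_cube m n (fst C) (snd C) theta) /\
    lsum (volume m n) l <= V.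

Lemma cube_cover_union {A} (m n : nat) (W : list A) (S : A -> mat -> Prop) (f : A -> R) :
  (forall w, In w W -> cube_cover m n (S w) (f w)) ->
  cube_cover m n (fun theta => exists w, In w W /\ S w theta) (lsum f W).
Proof.
  induction W as [|w W IH]; intros H.
  - exists []. split; [intros ? []|]. split; [intros theta (w & [] & _)|simpl; lra].
  - destruct (H w ltac:(simpl; auto)) as (l1 & P1 & C1 & V1).
    destruct IH as (l2 & P2 & C2 & V2); [intros; apply H; simpl; auto|].
    exists (l1 ++ l2). split; [|split].
    + intros C HC. apply in_app_or in HC as []; auto.
    + intros theta (w' & [<-|Hw'] & HS).
      * destruct (C1 theta HS) as (C & HC & Hin). exists C. split; [apply in_or_app; auto|exact Hin].
      * destruct (C2 theta) as (C & HC & Hin); [now exists w'|].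
        exists C. split; [apply in_or_app; auto|exact Hin].
    + rewrite lsum_app. simpl. lra.
Qed.

Lemma cube_cover_weaken (m n : nat) (S S' : mat -> Prop) (V V' : R) :
  (forall theta, S' theta -> S theta) -> V <= V' ->
  cube_cover m n S V -> cube_cover m n S' V'.
Proof.
  intros HS HV (l & P & C & Hl). exists l. split; [exact P|]. split; [auto|lra].
Qed.

Lemma in_subcube (m n M : nat) (a : mat) (s : R) (theta : mat) :
  (0 < M)%nat -> in_cube m n a s theta ->
  exists w, In w (grid m n M) /\ in_cube m n (subcube a (s / INR M) w) (s / INR M) theta.
Proof.
  intros HM Hin.
  destruct (choice (fun x k => 0 <= x <= s -> (k < M)%nat /\
     s / INR M * INR k <= x <= s / INR M * INR k + s / INR M)) as (f & Hf).
  { intros x. destruct (classic (0 <= x <= s)) as [Hx|Hx]; [|exists 0%nat; tauto].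
    destruct (subdivide x s M HM Hx) as (k & Hk). now exists k. }
  assert (Hin' : forall j r, (j < m)%nat -> (r < n)%nat -> 0 <= theta j r - a j r <= s).
  { intros j r Hj Hr. specialize (Hin j r Hj Hr). cbv beta in Hin. lra. }
  destruct (grid_entry m n M (fun j r => f (theta j r - a j r))) as (w & Hw & Hent).
  { intros j r Hj Hr. now apply Hf, Hin'. }
  exists w. split; [exact Hw|]. intros j r Hj Hr. unfold subcube.
  rewrite Hent by assumption. destruct (Hf _ (Hin' j r Hj Hr)) as [_ G]. lra.
Qed.

Lemma grid_length (m n M : nat) : INR (length (grid m n M)) = (INR M ^ n) ^ m.
Proof. unfold grid. rewrite !words_length, length_seq. now rewrite !pow_INR. Qed.

(** The cell [w] lies in [G] and is dropped; the other cells of the subdivision cover the rest. *)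
Lemma cover_minus_subcube (m n M : nat) (a : mat) (s : R) (G : mat -> Prop) (w : list (list nat)) :
  (0 < M)%nat -> 0 < s -> In w (grid m n M) ->
  (forall theta, in_cube m n (subcube a (s / INR M) w) (s / INR M) theta -> G theta) ->
  cube_cover m n (fun theta => in_cube m n a s theta /\ ~ G theta)
    ((s ^ n) ^ m * (1 - / (INR M ^ n) ^ m)).
Proof.
  intros HM Hs Hw HG. assert (HMR : 0 < INR M) by now apply lt_0_INR.
  set (sg := s / INR M) in *. assert (Hsg : 0 < sg) by now apply Rdiv_lt_0_compat.
  assert (dec : forall x y : list (list nat), {x = y} + {x <> y})
    by (repeat apply list_eq_dec; apply Nat.eq_dec).
  exists (map (fun w' => (subcube a sg w', sg)) (remove dec w (grid m n M))).
  split; [|split].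
  - intros C HC. apply in_map_iff in HC as (w' & <- & _). exact Hsg.
  - intros theta [Hin HnG].
    destruct (in_subcube m n M a s theta HM Hin) as (w' & Hw' & Hin').
    exists (subcube a sg w', sg). split; [|exact Hin'].
    apply (in_map (fun w' => (subcube a sg w', sg))). apply in_in_remove; [|exact Hw'].
    intros ->. now apply HnG, HG.
  - assert (Hlen := remove_length_lt dec _ _ Hw).
    assert (E : forall W, lsum (volume m n) (map (fun w' => (subcube a sg w', sg)) W)
                = INR (length W) * (sg ^ n) ^ m).
    { induction W as [|w' W IH]; [simpl; lra|]. cbn [map lsum length]. rewrite IH, S_INR.
      unfold volume. simpl snd. ring. }
    rewrite E.
    assert (HMn : 0 < (INR M ^ n) ^ m) by now apply pow_lt, pow_lt.
    assert (Hvs : (s ^ n) ^ m = (sg ^ n) ^ m * (INR M ^ n) ^ m).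
    { rewrite <- !Rpow_mult_distr. unfold sg. f_equal. f_equal. field. lra. }
    rewrite Hvs.
    replace ((sg ^ n) ^ m * (INR M ^ n) ^ m * (1 - / (INR M ^ n) ^ m))
      with (((INR M ^ n) ^ m - 1) * (sg ^ n) ^ m) by (field; lra).
    apply Rmult_le_compat_r; [apply pow_le, pow_le; lra|].
    apply le_INR in Hlen. rewrite S_INR, grid_length in Hlen. lra.
Qed.

Lemma exists_scale (x : R) : 1 <= x -> exists M : nat, (0 < M)%nat /\ x <= INR M <= 2 * x.
Proof.
  intros Hx. destruct (archimed x) as [H1 H2].
  assert (0 < up x)%Z by (apply lt_IZR; lra).
  exists (Z.to_nat (up x)). split; [lia|]. rewrite INR_IZR_INZ, Z2Nat.id by lia. lra.
Qed.

Lemma cover_cube_step (m n : nat) (c delta : R) (l : nat) (N : nat -> nat -> nat)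
  (v : nat -> nat -> Z) :
  (0 < m)%nat -> (0 < n)%nat -> 0 < c -> delta < 1 ->
  (forall i k, (i < l)%nat -> (k < m + n)%nat -> (0 < N i k)%nat) ->
  exists kappa, 0 < kappa <= 1 /\ forall (Q0 : nat) (a : mat) (s : R), 0 < s ->
    cube_cover m n (fun theta => in_cube m n a s theta /\
        ~ exists Q, (Q0 < Q)%nat /\ approximable m n c delta l N v theta Q)
      ((1 - kappa) * (s ^ n) ^ m).
Proof.
  intros Hm Hn Hc Hdelta HN.
  destruct (good_subcube m n c delta l N v Hm Hn Hc Hdelta HN) as (M2 & HM2 & Hgood).
  assert (HM2R : 1 <= INR M2) by (replace 1 with (INR 1) by reflexivity; apply le_INR; lia).
  assert (HM2p : 1 <= (INR M2 ^ n) ^ m) by now apply pow_R1_Rle, pow_R1_Rle.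
  set (k2 := / (INR M2 ^ n) ^ m).
  assert (Hk2 : 0 < k2 <= 1).
  { unfold k2. split; [apply Rinv_0_lt_compat; lra|].
    apply Rle_trans with (/ 1); [apply Rinv_le_contravar; lra|rewrite Rinv_1; lra]. }
  (* At least half of the cells have a good corner, and each of these loses a fraction [k2]. Neither
     factor depends on the cube or on [Q0], as the iteration requires. *)
  exists (/ 2 * k2). split; [lra|]. intros Q0 a s Hs.
  set (G := fun theta => exists Q, (Q0 < Q)%nat /\ approximable m n c delta l N v theta Q).
  destruct (Hgood Q0) as (T0 & HT0).
  destruct (count_bad m n a s Hm Hn Hs) as (T1 & HT1).
  destruct (archimed_nat (/ s)) as (T2 & HT2).
  (* [T] is a multiple of 24 so that [T ^ m / 24] is an integer. *)
  set (t := (1 + T0 + T1 + T2)%nat). set (T := (24 * t)%nat).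
  set (H := (t * T ^ (m - 1))%nat).
  assert (HH : (24 * H = T ^ m)%nat).
  { unfold H. destruct m as [|m']; [lia|]. replace (S m' - 1)%nat with m' by lia.
    rewrite Nat.mul_assoc. fold T. reflexivity. }
  assert (HTR : 1 <= INR T) by (replace 1 with (INR 1) by reflexivity; apply le_INR; unfold T, t; lia).
  assert (HTs : / s <= INR T) by (apply HT2; unfold T, t; lia).
  set (D := INR T ^ (m + n)).
  assert (HTD : INR T <= D).
  { replace (INR T) with (INR T ^ 1) by ring. apply Rle_pow; [exact HTR|lia]. }
  assert (HsD : 1 <= s * D).
  { apply Rle_trans with (s * / s); [right; field; lra|]. apply Rmult_le_compat_l; lra. }
  (* Puts the side [s / INR M] between [/ 2 * / D] and [/ D]. *)
  destruct (exists_scale (s * D) HsD) as (M & HM & HsM).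
  assert (HMR : 0 < INR M) by now apply lt_0_INR.
  set (sg := s / INR M).
  assert (Hsg0 : 0 < sg) by now apply Rdiv_lt_0_compat.
  assert (Hsg : / 2 * / D <= sg <= / D).
  { unfold sg. split.
    - apply Rmult_le_reg_r with (D * INR M); [nra|].
      replace (/ 2 * / D * (D * INR M)) with (/ 2 * INR M) by (field; lra).
      replace (s / INR M * (D * INR M)) with (s * D) by (field; lra). lra.
    - apply Rmult_le_reg_r with (D * INR M); [nra|].
      replace (/ D * (D * INR M)) with (INR M) by (field; lra).
      replace (s / INR M * (D * INR M)) with (s * D) by (field; lra). lra. }
  pose (bd := fun w => bad m n H (/ (24 * INR T ^ n)) (subcube a sg w)).
  assert (Hcount : count bd (grid m n M) <= / 2 * (INR M ^ n) ^ m).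
  { apply (HT1 T H M); [unfold T, t; lia|unfold T, t; lia|exact HH|exact HM|apply Hsg]. }
  (* Cells with a bad corner are kept whole; in the others the proportion [k2] of the volume is
     removed. *)
  apply cube_cover_weaken with
    (S := fun theta => exists w, In w (grid m n M) /\
            (in_cube m n (subcube a sg w) sg theta /\ ~ G theta))
    (V := lsum (fun w => (sg ^ n) ^ m * (1 - k2 * indicator (~ bd w))) (grid m n M)).
  - intros theta [Hin HnG]. destruct (in_subcube m n M a s theta HM Hin) as (w & Hw & Hin').
    now exists w.
  - rewrite lsum_scal.
    assert (E : forall W, lsum (fun w => 1 - k2 * indicator (~ bd w)) W
                = INR (length W) - k2 * count (fun w => ~ bd w) W).
    { induction W as [|w W IH]; [simpl; lra|]. cbn [lsum count length].
      rewrite IH, S_INR. ring. }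
    rewrite E, grid_length.
    assert (Hnot := count_not bd (grid m n M)). rewrite grid_length in Hnot.
    assert (Hvs : (s ^ n) ^ m = (sg ^ n) ^ m * (INR M ^ n) ^ m).
    { rewrite <- !Rpow_mult_distr. unfold sg. f_equal. f_equal. field. lra. }
    rewrite Hvs.
    replace ((1 - / 2 * k2) * ((sg ^ n) ^ m * (INR M ^ n) ^ m))
      with ((sg ^ n) ^ m * ((INR M ^ n) ^ m - k2 * (/ 2 * (INR M ^ n) ^ m))) by ring.
    apply Rmult_le_compat_l; [apply pow_le, pow_le; lra|]. nra.
  - apply cube_cover_union. intros w Hw. destruct (classic (bd w)) as [Hb|Hb].
    + rewrite indicator_false by tauto. exists [(subcube a sg w, sg)]. split; [|split].
      * intros C [<-|[]]. exact Hsg0.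
      * intros theta [Hin _]. eexists. split; [left; reflexivity|exact Hin].
      * simpl. unfold volume. simpl snd. lra.
    + rewrite indicator_true by exact Hb. rewrite Rmult_1_r.
      destruct (HT0 T H ltac:(unfold T, t; lia) HH (subcube a sg w) sg Hsg Hb) as (w2 & Hw2 & HG2).
      now apply cover_minus_subcube with w2.
Qed.

(** Applying the step to every cube of a cover multiplies the bound on the total volume by
    [1 - kappa], and the powers of this factor tend to 0. *)
Lemma cover_cube_small (m n : nat) (kappa : R) (G : mat -> Prop) (a : mat) (s eps : R) :
  0 < kappa <= 1 -> 0 < s -> 0 < eps ->
  (forall a s, 0 < s ->
    cube_cover m n (fun theta => in_cube m n a s theta /\ ~ G theta)
      ((1 - kappa) * (s ^ n) ^ m)) ->
  cube_cover m n (fun theta => in_cube m n a s theta /\ ~ G theta) eps.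
Proof.
  intros Hk Hs He Hstep.
  assert (Hiter : forall i, cube_cover m n (fun theta => in_cube m n a s theta /\ ~ G theta)
                    ((1 - kappa) ^ i * (s ^ n) ^ m)).
  { induction i as [|i (l & Hpos & Hcov & Hvol)].
    - exists [(a, s)]. split; [|split].
      + intros C [<-|[]]. exact Hs.
      + intros theta [Hin _]. eexists. split; [left; reflexivity|exact Hin].
      + simpl. unfold volume. simpl snd. lra.
    - apply cube_cover_weaken with
        (S := fun theta => exists C, In C l /\ (in_cube m n (fst C) (snd C) theta /\ ~ G theta))
        (V := lsum (fun C => (1 - kappa) * volume m n C) l).
      + intros theta [Hin HnG]. destruct (Hcov theta (conj Hin HnG)) as (C & HC & HinC).
        now exists C.
      + rewrite lsum_scal. simpl. apply (Rmult_le_compat_l (1 - kappa)) in Hvol; lra.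
      + apply cube_cover_union. intros C HC. now apply Hstep, Hpos. }
  set (V := (s ^ n) ^ m) in *.
  assert (HV : 0 < V) by (apply pow_lt, pow_lt, Hs).
  destruct (pow_lt_1_zero (1 - kappa)) with (y := eps / V) as (i & Hi).
  - rewrite Rabs_right; lra.
  - now apply Rdiv_lt_0_compat.
  - specialize (Hi i (le_n i)). rewrite Rabs_right in Hi by (apply Rle_ge, pow_le; lra).
    apply cube_cover_weaken with (3 := Hiter i); [auto|].
    apply (Rmult_lt_compat_r V) in Hi; [|exact HV].
    replace (eps / V * V) with eps in Hi by (field; lra). lra.
Qed.

(** * Concatenating countably many finite lists *)

Section Concatenation.
Context {A : Type} (d : A) (L : nat -> list A).

(* The separator [d] makes the first [K] blocks contain at least [K] entries. *)
Fixpoint blocks (K : nat) : list A :=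
  match K with O => [] | S K' => blocks K' ++ d :: L K' end.

Lemma blocks_length K : (K <= length (blocks K))%nat.
Proof. induction K as [|K IH]; simpl; [lia|]. rewrite length_app. simpl. lia. Qed.

Lemma nth_blocks K K' k :
  (K <= K')%nat -> (k < length (blocks K))%nat -> nth k (blocks K') d = nth k (blocks K) d.
Proof.
  intros HK Hk. induction HK as [|K' HK IH]; [reflexivity|]. simpl.
  rewrite app_nth1; [exact IH|]. eapply Nat.lt_le_trans; [exact Hk|].
  clear IH. induction HK as [|K' HK IH]; [lia|]. simpl. rewrite length_app. lia.
Qed.

(** [blocks (S k)] has more than [k] entries and longer concatenations extend it, so [nth] never
    falls back on its default. *)
Definition flat (k : nat) : A := nth k (blocks (S k)) d.

Lemma flat_nth K k : (k < length (blocks K))%nat -> flat k = nth k (blocks K) d.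
Proof.
  intros Hk. unfold flat. assert (Hk' := blocks_length (S k)).
  destruct (Nat.le_ge_cases K (S k)) as [H|H]; [now apply nth_blocks|].
  symmetry. apply nth_blocks; [exact H|lia].
Qed.

Lemma flat_in i x : In x (L i) -> exists k, flat k = x.
Proof.
  intros Hx. destruct (In_nth (blocks (S i)) x d) as (k & Hk & E).
  - simpl. apply in_or_app. right. now right.
  - exists k. now rewrite (flat_nth (S i)).
Qed.

Lemma flat_from k : flat k = d \/ exists i, In (flat k) (L i).
Proof.
  assert (G : forall K x, In x (blocks K) -> x = d \/ exists i, In x (L i)).
  { induction K as [|K IH]; intros x; simpl; [tauto|]. intros Hx.
    apply in_app_or in Hx as [Hx|[->|Hx]]; eauto. }
  apply (G (S k)). apply nth_In. apply (blocks_length (S k)).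
Qed.

(** The first [K] entries all lie in the first [K] blocks, where separators weigh 0 and all other
    weights are nonnegative. *)
Lemma sum_flat_le (f : A -> R) (e : nat -> R) (K : nat) :
  f d = 0 -> (forall i x, In x (L i) -> 0 <= f x) -> (forall i, lsum f (L i) <= e i) ->
  sumR K (fun k => f (flat k)) <= sumR K e.
Proof.
  intros Hd Hf He.
  assert (G : forall x, In x (blocks K) -> 0 <= f x).
  { induction K as [|K' IH]; intros x; simpl; [tauto|]. intros Hx.
    apply in_app_or in Hx as [Hx|[<-|Hx]]; [now apply IH|lra|eauto]. }
  apply Rle_trans with (lsum f (blocks K)).
  - rewrite (sumR_ext _ _ (fun k => f (nth k (blocks K) d))).
    + apply sumR_nth_le; [exact G|apply blocks_length].
    + intros k Hk. f_equal. apply flat_nth. assert (H := blocks_length K). lia.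
  - clear G. induction K as [|K IH]; simpl; [lra|].
    rewrite lsum_app. simpl. rewrite Hd. specialize (He K). lra.
Qed.

End Concatenation.

Lemma sumR_geometric (eps : R) (K : nat) : 0 < eps ->
  sumR K (fun i => eps * (/ 2) ^ S i) <= eps.
Proof.
  intros He.
  assert (E : sumR K (fun i => eps * (/ 2) ^ S i) = eps * (1 - (/ 2) ^ K)).
  { induction K as [|K IH]; [simpl; ring|]. cbn [sumR]. rewrite IH. simpl. lra. }
  rewrite E. assert (0 <= (/ 2) ^ K) by (apply pow_le; lra). nra.
Qed.

(** Countable subadditivity: the [i]-th cover is allowed volume [eps / 2 ^ (i + 1)], and the finite
    covers are strung into one sequence. *)
Lemma null_of_cube_covers (m n : nat) (S : mat -> Prop) (F : nat -> mat -> Prop) :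
  (0 < m)%nat -> (0 < n)%nat ->
  (forall theta, S theta -> exists i, F i theta) ->
  (forall i eps, 0 < eps -> cube_cover m n (F i) eps) ->
  lebesgue_null m n S.
Proof.
  intros Hm Hn HS HF eps He.
  destruct (choice (fun i l =>
     (forall C : mat * R, In C l -> 0 < snd C) /\
     (forall theta, F i theta -> exists C, In C l /\ in_cube m n (fst C) (snd C) theta) /\
     lsum (volume m n) l <= eps * (/ 2) ^ Datatypes.S i)) as (L & HL).
  { intros i. apply HF. apply Rmult_lt_0_compat; [exact He|]. apply pow_lt. lra. }
  (* The separator is a cube of side 0, whose volume vanishes because [m] and [n] are positive. *)
  set (d := ((fun _ _ => 0) : mat, 0)).
  set (C := flat d L).
  assert (Hside : forall k, 0 <= snd (C k)).
  { intros k. destruct (flat_from d L k) as [E|(i & Hi)].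
    - unfold C. rewrite E. simpl. lra.
    - apply Rlt_le. now apply (proj1 (HL i)). }
  exists (fun k => fst (C k)), (fun k j r => fst (C k) j r + snd (C k)).
  split; [|split].
  - intros k j r _ _. specialize (Hside k). lra.
  - intros K. eapply Rle_trans; [|apply (sumR_geometric eps K He)].
    rewrite (sumR_ext _ _ (fun k => volume m n (C k))).
    + apply sum_flat_le.
      * unfold volume, d. simpl snd. rewrite !pow_i by lia. reflexivity.
      * intros i x Hx. apply pow_le, pow_le, Rlt_le. now apply (proj1 (HL i)).
      * intros i. apply HL.
    + intros k _. unfold box_vol, volume. apply prodR_const. intros j _.
      apply prodR_const. intros r _. ring.
  - intros theta Htheta. destruct (HS theta Htheta) as (i & Hi).
    destruct (HL i) as (_ & Hcov & _). destruct (Hcov theta Hi) as (C0 & HC0 & Hin).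
    destruct (flat_in d L i C0 HC0) as (k & Hk). exists k. unfold C. rewrite Hk. exact Hin.
Qed.

(* Indices are 0-based: i < l (i = 0 is the distinguished first index),
   coordinates j < m for p and r < n for q; the congruence data for the
   coordinate k < d = m + n of the i-th pair is N i k, v i k. *)
Theorem theorem1p3 (m n : nat) (hm : (0 < m)%nat) (hn : (0 < n)%nat)
  (c delta : R) (hc : 0 < c) (hdelta : delta < 1) (l : nat)
  (N : nat -> nat -> nat) (v : nat -> nat -> Z)
  (hN : forall i k, (i < l)%nat -> (k < m + n)%nat -> (0 < N i k)%nat) :
  ae_mat m n (fun theta =>
    forall Q0 : nat, exists Q : nat, (Q0 < Q)%nat /\
      exists (p q : nat -> nat -> Z),
        (forall i, (i < l)%nat -> supnorm n (fun r => IZR (q i r)) <= INR Q) /\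
        ((0 < l)%nat ->
           supnorm m (lin_form m n theta (q 0%nat) (p 0%nat)) ^ m
             <= c / (INR Q ^ n)) /\
        (forall i, (1 <= i)%nat -> (i < l)%nat ->
           supnorm m (lin_form m n theta (q i) (p i)) ^ m
             <= c * Rpower (INR Q) (- (delta * INR n))) /\
        (forall i, (i < l)%nat ->
           (forall j, (j < m)%nat -> zcong (p i j) (v i j) (N i j)) /\
           (forall r, (r < n)%nat -> zcong (q i r) (v i (m + r)%nat) (N i (m + r)%nat)))).
Proof.
  destruct (cover_cube_step m n c delta l N v hm hn hc hdelta hN) as (kappa & Hkappa & Hstep).
  (* The [K]-th piece consists of the points of the cube of half-side [K + 1] about the origin for
     which no [Q] beyond [K] works; [S K] keeps the side positive. *)
  apply null_of_cube_covers with (F := fun K theta =>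
    in_cube m n (fun _ _ => - INR (S K)) (2 * INR (S K)) theta /\
    ~ exists Q, (K < Q)%nat /\ approximable m n c delta l N v theta Q); auto.
  - intros theta Htheta. apply not_all_ex_not in Htheta as (Q0 & HQ0).
    destruct (eventually_forall m (fun j S => forall r, (r < n)%nat -> Rabs (theta j r) <= INR S))
      as (B & HB).
    { intros j _. apply eventually_forall. intros r _. apply archimed_nat. }
    (* Failure beyond [Q0] persists beyond any larger bound and the cubes increase, so one index can
       serve both purposes. *)
    exists (Q0 + B)%nat. split.
    + intros j r Hj Hr. specialize (HB (S (Q0 + B)) ltac:(lia) j Hj r Hr).
      apply Rabs_le_inv in HB. lra.
    + intros (Q & HQ & Happ). apply HQ0. exists Q. split; [lia|exact Happ].
  - intros K eps He. apply cover_cube_small with kappa; auto.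
    assert (0 < INR (S K)) by (apply lt_0_INR; lia). lra.
Qed.
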